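(* For every $\gamma>-1$, $$I_0^H\big(x^{2+2\gamma}\,C^\infty_{\mathrm{ev}}(\mathbb D_H)\big)\subset \mu_H^{2\gamma+2}\,C^\infty_{\alpha,+}(\overline{\mathcal G_H}).$$
   Context: $\mathbb D_H=\{z\in\mathbb C:|z|\le1\}$, whose interior carries the Poincaré metric $g_H=c(z)^{-2}|dz|^2$, $c(z)=(1-|z|^2)/2$. Let $x(z)=\frac{1-|z|^2}{1+|z|^2}$, a boundary defining function. $C^\infty_{\mathrm{ev}}(\mathbb D_H)$ is the space of smooth functions on $\mathbb D_H$ whose Taylor expansion off of $\partial\mathbb D_H$, written in terms of $x$ (and $\omega=\arg z$), contains only even powers of $x$. Geodesics: $\mathcal G_H=\mathbb S^1_\beta\times\mathbb R_a$ and $\gamma_{\beta,a}(t)=e^{i\beta}\frac{(2+ia)\tanh(t/2)+ia}{ia\tanh(t/2)-2+ia}$, $t\in\mathbb R$ (unit-speed $g_H$-geodesics). The hyperbolic X-ray transform is $I_0^Hf(\beta,a)=\int_{\mathbb R}f(\gamma_{\beta,a}(t))\,dt$. Let $\mu_H(\beta,a)=(1+a^2)^{-1/2}$. $\overline{\mathcal G_H}=\mathbb S^1\times[-\infty,\infty]$ has the smooth structure making $\Psi_{hf}(\beta,a)=(\beta,\tan^{-1}a)$ a diffeomorphism onto $\partial_+S\mathbb D_E=\mathbb S^1_\beta\times[-\pi/2,\pi/2]_\alpha$. Fan-beam coordinates $(\beta,\alpha)\in\mathbb S^1\times\mathbb R/2\pi\mathbb Z$ on $\partial S\mathbb D_E$: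 unit vector at $e^{i\beta}$ with direction $e^{i(\beta+\pi+\alpha)}$; $\partial_\pm S\mathbb D_E$ correspond to $\alpha\in[-\pi/2,\pi/2]$, resp. $[\pi/2,3\pi/2]$. $\mathcal S^E(\beta,\alpha)=(\beta+\pi+2\alpha,\pi-\alpha)$, $\mathcal S^E_A(\beta,\alpha)=(\beta+\pi+2\alpha,-\alpha)$; $A_+u=u$ on $\partial_+$, $u\circ\mathcal S^E$ on $\partial_-$. $C^\infty_{\alpha,+}(\partial_+S\mathbb D_E)=\{u\in C^\infty(\partial_+S\mathbb D_E):A_+u\in C^\infty(\partial S\mathbb D_E),\ u\circ\mathcal S^E_A=u\}$ and $C^\infty_{\alpha,+}(\overline{\mathcal G_H})=\Psi_{hf}^*C^\infty_{\alpha,+}(\partial_+S\mathbb D_E)$. *)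

(* Defs.v *)
From Stdlib Require Import Reals Lra List.
From Coquelicot Require Import Coquelicot.
Open Scope R_scope.

Fixpoint pderiv (ds : list bool) (g : R -> R -> R) : R -> R -> R :=
  match ds with
  | nil => g
  | true :: ds' => fun x y => Derive (fun x' => pderiv ds' g x' y) x
  | false :: ds' => fun x y => Derive (fun y' => pderiv ds' g x y') y
  end.

Definition smooth2 (g : R -> R -> R) : Prop :=
  forall (ds : list bool) (x y : R),
    ex_derive (fun x' => pderiv ds g x' y) x /\
    ex_derive (fun y' => pderiv ds g x y') y /\
    continuity_2d_pt (pderiv ds g) x y.

Definition smooth2C (g : R -> R -> C) : Prop :=
  smooth2 (fun x y => fst (g x y)) /\ smooth2 (fun x y => snd (g x y)).

(** C^infinity(D_H): a function on the closed unit disk that is smooth up to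
    the boundary, represented by a smooth function on the whole plane
    (only its values on the closed disk matter). *)
Definition Cinf_disk (h : C -> C) : Prop :=
  smooth2C (fun x y => h (x, y)).

Definition xdef (z : C) : R := (1 - Cmod z ^ 2) / (1 + Cmod z ^ 2).

(** inverse of |z| -> x: |z| = sqrt((1-x)/(1+x)), valid for x in (-1,1] *)
Definition rad_of_x (x : R) : R := sqrt ((1 - x) / (1 + x)).

Definition in_x_omega (h : C -> C) (x om : R) : C :=
  h (rad_of_x x * cos om, rad_of_x x * sin om).

(** C^infinity_ev(D_H): smooth on the closed disk and the Taylor expansion in
    x at the boundary x = 0 (for every fixed omega) contains only even powers
    of x, i.e. all odd x-derivatives vanish at x = 0. *)
Definition Cinf_ev (h : C -> C) : Prop :=
  Cinf_disk h /\
  forall (k : nat) (om : R),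
    Derive_n (fun x => fst (in_x_omega h x om)) (2 * k + 1) 0 = 0 /\
    Derive_n (fun x => snd (in_x_omega h x om)) (2 * k + 1) 0 = 0.

Definition tanh (t : R) : R := (exp t - exp (- t)) / (exp t + exp (- t)).

Definition cis (b : R) : C := (cos b, sin b).

(** unit speed hyperbolic geodesics gamma_{beta,a}(t) *)
Definition gammaH (beta a t : R) : C :=
  (cis beta * (((RtoC 2 + Ci * RtoC a) * RtoC (tanh (t / 2)) + Ci * RtoC a)
     / (Ci * RtoC a * RtoC (tanh (t / 2)) - RtoC 2 + Ci * RtoC a)))%C.

Definition muH (a : R) : R := / sqrt (1 + a ^ 2).

(** C^infinity_{alpha,+}(d_+ S D_E), functions u(beta, alpha) with beta in
    S^1 (represented 2pi-periodically on R) and alpha in [-pi/2, pi/2]: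
    - A_+ u is smooth on the torus d S D_E: there is a smooth, doubly
      2pi-periodic U on R^2 with U = u on alpha in [-pi/2,pi/2] and
      U = u o S^E on alpha in [pi/2, 3pi/2]  (so U = A_+ u);
    - u o S^E_A = u. *)
Definition Cinf_alpha_plus (u : R -> R -> C) : Prop :=
  (forall beta alpha, u (beta + 2 * PI) alpha = u beta alpha) /\
  (exists U : R -> R -> C,
      smooth2C U /\
      (forall beta alpha, U (beta + 2 * PI) alpha = U beta alpha) /\
      (forall beta alpha, U beta (alpha + 2 * PI) = U beta alpha) /\
      (forall beta alpha, - PI / 2 <= alpha <= PI / 2 ->
          U beta alpha = u beta alpha) /\
      (forall beta alpha, PI / 2 <= alpha <= 3 * PI / 2 ->
          U beta alpha = u (beta + PI + 2 * alpha) (PI - alpha))) /\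
  (forall beta alpha, - PI / 2 <= alpha <= PI / 2 ->
      u (beta + PI + 2 * alpha) (- alpha) = u beta alpha).

(* Main.v *)
Require Import Defs.
From Stdlib Require Import Reals Lra Lia List Classical ClassicalEpsilon FunctionalExtensionality.
From Coquelicot Require Import Coquelicot.
Open Scope R_scope.

(** Put [a = tan al] and [s = t - ln (cos al)]. Then [x = cos al / cosh s] along the geodesic, and
    the geodesic itself is [P / (1 + x)] with
    [P = - e^(i (beta + al)) (cos al tanh s + i sin al)] its Klein model, [|P|^2 = 1 - x^2]. Hence
    the X-ray transform is [(cos al)^(2 gam + 2)] times
    [u beta al = int (cosh s)^(-2 gam - 2) h (P / (1 + x)) ds], a bounded positive functional
    applied to functions whose derivatives in [(beta, al)] are bounded uniformly in [s].
    The antipodal scattering relation is [s -> - s]. The scattering relation changes the sign of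
    [x] and fixes [P], so that [A_+ u] glues the integrals of [h (P / (1 + x))] and
    [h (P / (1 - x))] along [x = 0]. Their difference is [O(x^N)] for every [N], because only even
    powers of [x] occur in the expansion of [h]; so the gluing is smooth. *)

(** * Differentiable families with uniform bounds *)

(** The shift by [ln (cos al)] makes the limit [cos al -> 0] harmless. After it, [beta] and [al]
    enter through trigonometric functions only, and [s] enters through the bounded functions
    [tanh s] and [1 / cosh s]. One integrable weight then dominates every derivative, and the
    exponent [2 gam + 2] only has to be positive. The formulas make sense for every real [al]. Past
    [cos al = 0] they have [x < 0], and [P / (1 + x)] leaves the disk, so the extension of [h] to
    the plane is evaluated there. The points [P / (1 + x)] and [P / (1 - x)] are inverse to each
    other in the unit circle. Evenness therefore says that [h] and its composition with the
    inversion agree to infinite order on the circle. On [cos al < 0] the glued function takes the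
    second point, so it sees [h] on the closed disk only. The pole of [1 / (1 + x)] at [x = -1] lies
    inside the region that the gluing overwrites, so [1 / (1 + x)] may be altered near it. The
    expansion of [h] bounds only the difference of the two integrals; bounds on its derivatives are
    recovered by interpolation. *)

Lemma and4_intro (A B C D : Prop) : A -> B -> C -> D -> A /\ B /\ C /\ D.
Proof. tauto. Qed.

Definition locally_bounded (K : R -> R -> R -> R) : Prop :=
  forall r, exists M, forall s x y, Rabs x <= r -> Rabs y <= r -> Rabs (K s x y) <= M.

(** [s] is the variable of integration: no regularity beyond continuity is asked in it, and
    the bounds on the derivatives in [(x, y)] are uniform in it. *)
Fixpoint Ck (n : nat) (K : R -> R -> R -> R) : Prop :=
  locally_bounded K /\
  (forall s x y, continuous (fun s' => K s' x y) s) /\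
  match n with
  | O => True
  | S n' => exists K1 K2,
      (forall s x y, is_derive (fun x' => K s x' y) x (K1 s x y)) /\
      (forall s x y, is_derive (fun y' => K s x y') y (K2 s x y)) /\
      Ck n' K1 /\ Ck n' K2
  end.

Definition Cinf (K : R -> R -> R -> R) : Prop := forall n, Ck n K.

Definition Cinf2 (g : R -> R -> R) : Prop := Cinf (fun _ => g).

Lemma Ck_bounded n K : Ck n K -> locally_bounded K.
Proof. destruct n; intros [H _]; exact H. Qed.

Lemma Ck_continuous n K : Ck n K -> forall s x y, continuous (fun s' => K s' x y) s.
Proof. destruct n; intros [_ [H _]]; exact H. Qed.

Lemma Ck_pred n : forall K, Ck (S n) K -> Ck n K.
Proof.
  induction n as [|n IH]; intros K HK.
  - destruct HK as [HB [HC _]]. now split.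
  - destruct HK as [HB [HC [K1 [K2 [H1 [H2 [C1 C2]]]]]]].
    split; [exact HB|split; [exact HC|]].
    exists K1, K2. split; [exact H1|split; [exact H2|split; apply IH; assumption]].
Qed.

Lemma Ck_S_1 n : forall K, Ck (S n) K -> Ck 1 K.
Proof. induction n as [|n IH]; intros K HK; [exact HK|apply IH, Ck_pred, HK]. Qed.

Lemma Ck_ext n K K' : (forall s x y, K s x y = K' s x y) -> Ck n K -> Ck n K'.
Proof.
  intros H HK. replace K' with K; [exact HK|].
  apply functional_extensionality; intro s; apply functional_extensionality; intro x;
    apply functional_extensionality; intro y; apply H.
Qed.

Lemma Ck_param n : forall k : R -> R,
  (exists M, forall s, Rabs (k s) <= M) -> (forall s, continuous k s) ->
  Ck n (fun s _ _ => k s).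
Proof.
  induction n as [|n IH]; intros k [M HM] Hk.
  - split; [|split; [|exact I]].
    + intro r; exists M; intros; apply HM.
    + intros s _ _; apply Hk.
  - split; [|split].
    + intro r; exists M; intros; apply HM.
    + intros s _ _; apply Hk.
    + exists (fun _ _ _ => 0), (fun _ _ _ => 0).
      assert (C0 : Ck n (fun _ _ _ => 0)).
      { apply (IH (fun _ => 0)).
        - exists 0; intros; rewrite Rabs_R0; lra.
        - intro s; apply continuous_const. }
      apply and4_intro; auto; intros s x y; apply (is_derive_const (k s)).
Qed.

Lemma Ck_const n (c : R) : Ck n (fun _ _ _ => c).
Proof.
  apply (Ck_param n (fun _ => c)).
  - exists (Rabs c); intros; lra.
  - intro s; apply continuous_const.
Qed.

Lemma Ck_fst n : Ck n (fun _ x _ => x).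
Proof.
  destruct n as [|n].
  - split; [|split; [|exact I]].
    + intro r; exists r; auto.
    + intros s x y; apply continuous_const.
  - split; [|split].
    + intro r; exists r; auto.
    + intros s x y; apply continuous_const.
    + exists (fun _ _ _ => 1), (fun _ _ _ => 0).
      apply and4_intro; try apply Ck_const; intros s x y.
      * apply (is_derive_id x).
      * apply (is_derive_const x).
Qed.

Lemma Ck_snd n : Ck n (fun _ _ y => y).
Proof.
  destruct n as [|n].
  - split; [|split; [|exact I]].
    + intro r; exists r; auto.
    + intros s x y; apply continuous_const.
  - split; [|split].
    + intro r; exists r; auto.
    + intros s x y; apply continuous_const.
    + exists (fun _ _ _ => 0), (fun _ _ _ => 1).
      apply and4_intro; try apply Ck_const; intros s x y.
      * apply (is_derive_const y).
      * apply (is_derive_id y).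
Qed.

Lemma Ck_plus n : forall K L, Ck n K -> Ck n L -> Ck n (fun s x y => K s x y + L s x y).
Proof.
  induction n as [|n IH]; intros K L HK HL;
    pose proof (Ck_bounded _ _ HK) as BK; pose proof (Ck_bounded _ _ HL) as BL;
    pose proof (Ck_continuous _ _ HK) as CK; pose proof (Ck_continuous _ _ HL) as CL;
    (split; [intro r; destruct (BK r) as [M1 HM1]; destruct (BL r) as [M2 HM2];
      exists (M1 + M2); intros s x y Hx Hy;
      eapply Rle_trans; [apply Rabs_triang|apply Rplus_le_compat; auto]|
    split; [intros s x y; apply (continuous_plus (fun s => K s x y) (fun s => L s x y)); auto|]]).
  - exact I.
  - destruct HK as [_ [_ [K1 [K2 [HK1 [HK2 [CK1 CK2]]]]]]].
    destruct HL as [_ [_ [L1 [L2 [HL1 [HL2 [CL1 CL2]]]]]]].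
    exists (fun s x y => K1 s x y + L1 s x y), (fun s x y => K2 s x y + L2 s x y).
    apply and4_intro; auto; intros s x y.
    + apply (is_derive_plus (fun x => K s x y) (fun x => L s x y)); auto.
    + apply (is_derive_plus (fun y => K s x y) (fun y => L s x y)); auto.
Qed.

Lemma Ck_mult n : forall K L, Ck n K -> Ck n L -> Ck n (fun s x y => K s x y * L s x y).
Proof.
  induction n as [|n IH]; intros K L HK HL;
    pose proof (Ck_bounded _ _ HK) as BK; pose proof (Ck_bounded _ _ HL) as BL;
    pose proof (Ck_continuous _ _ HK) as CK; pose proof (Ck_continuous _ _ HL) as CL;
    (split; [intro r; destruct (BK r) as [M1 HM1]; destruct (BL r) as [M2 HM2];
      exists (M1 * M2); intros s x y Hx Hy; rewrite Rabs_mult;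
      apply Rmult_le_compat; auto using Rabs_pos|
    split; [intros s x y; apply (continuous_mult (fun s => K s x y) (fun s => L s x y)); auto|]]).
  - exact I.
  - pose proof (Ck_pred _ _ HK) as PK. pose proof (Ck_pred _ _ HL) as PL.
    destruct HK as [_ [_ [K1 [K2 [HK1 [HK2 [CK1 CK2]]]]]]].
    destruct HL as [_ [_ [L1 [L2 [HL1 [HL2 [CL1 CL2]]]]]]].
    exists (fun s x y => K1 s x y * L s x y + K s x y * L1 s x y),
      (fun s x y => K2 s x y * L s x y + K s x y * L2 s x y).
    apply and4_intro; try (apply Ck_plus; apply IH; assumption); intros s x y.
    + apply (is_derive_mult (fun x => K s x y) (fun x => L s x y)); auto.
      intros; apply Rmult_comm.
    + apply (is_derive_mult (fun y => K s x y) (fun y => L s x y)); auto.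
      intros; apply Rmult_comm.
Qed.

Lemma Ck_opp n K : Ck n K -> Ck n (fun s x y => - K s x y).
Proof.
  intro HK. apply Ck_ext with (fun s x y => -1 * K s x y); [intros; ring|].
  apply Ck_mult; [apply Ck_const|exact HK].
Qed.

Lemma Ck_minus n K L : Ck n K -> Ck n L -> Ck n (fun s x y => K s x y - L s x y).
Proof. intros HK HL. apply (Ck_plus n K (fun s x y => - L s x y)); [|apply Ck_opp]; assumption. Qed.

Lemma Ck_inv n (m : R) : 0 < m -> forall K, (forall s x y, m <= K s x y) -> Ck n K ->
  Ck n (fun s x y => / K s x y).
Proof.
  intros Hm. induction n as [|n IH]; intros K HmK HK;
    pose proof (Ck_continuous _ _ HK) as CK;
    (assert (HP : forall s x y, K s x y <> 0) by (intros s x y; specialize (HmK s x y); lra));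
    (split; [intro r; exists (/ m); intros s x y _ _; specialize (HmK s x y);
      rewrite Rabs_pos_eq;
      [apply Rinv_le_contravar; lra|left; apply Rinv_0_lt_compat; lra]|
    split; [intros s x y; apply (continuous_Rinv_comp (fun s => K s x y)); auto|]]).
  - exact I.
  - pose proof (Ck_pred _ _ HK) as PK.
    destruct HK as [_ [_ [K1 [K2 [HK1 [HK2 [CK1 CK2]]]]]]].
    exists (fun s x y => - K1 s x y * (/ K s x y * / K s x y)),
      (fun s x y => - K2 s x y * (/ K s x y * / K s x y)).
    apply and4_intro;
      try (apply Ck_mult; [apply Ck_opp; assumption|apply Ck_mult; apply IH; assumption]);
      intros s x y.
    + replace (- K1 s x y * (/ K s x y * / K s x y)) with (- K1 s x y / K s x y ^ 2)
        by (field; auto).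
      apply (is_derive_inv (fun x => K s x y)); auto.
    + replace (- K2 s x y * (/ K s x y * / K s x y)) with (- K2 s x y / K s x y ^ 2)
        by (field; auto).
      apply (is_derive_inv (fun y => K s x y)); auto.
Qed.

Lemma is_derive_Rabs_le (f df : R -> R) (M a b : R) :
  (forall x, is_derive f x (df x)) ->
  (forall x, Rmin a b <= x <= Rmax a b -> Rabs (df x) <= M) ->
  Rabs (f b - f a) <= M * Rabs (b - a).
Proof.
  intros Hf HM.
  destruct (MVT_gen f a b df) as [c [Hc ->]].
  - intros; apply Hf.
  - intros x _. apply continuity_pt_filterlim.
    apply (ex_derive_continuous (K := R_AbsRing) (V := R_NormedModule)).
    now exists (df x).
  - rewrite Rabs_mult. apply Rmult_le_compat_r; auto using Rabs_pos.
Qed.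

Lemma Rabs_between (a b c r : R) :
  Rmin a b <= c <= Rmax a b -> Rabs a <= r -> Rabs b <= r -> Rabs c <= r.
Proof.
  intros Hc Ha Hb. apply Rabs_le.
  apply Rabs_le_between in Ha. apply Rabs_le_between in Hb.
  unfold Rmin, Rmax in Hc. destruct (Rle_dec a b); lra.
Qed.

Lemma Ck_lipschitz K : Ck 1 K -> forall r, exists M, 0 <= M /\ forall s x y x' y',
  Rabs x <= r -> Rabs y <= r -> Rabs x' <= r -> Rabs y' <= r ->
  Rabs (K s x' y' - K s x y) <= M * (Rabs (x' - x) + Rabs (y' - y)).
Proof.
  intros [_ [_ [K1 [K2 [H1 [H2 [C1 C2]]]]]]] r.
  destruct (Ck_bounded _ _ C1 r) as [M1 HM1]. destruct (Ck_bounded _ _ C2 r) as [M2 HM2].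
  exists (Rmax 0 (Rmax M1 M2)). split; [apply Rmax_l|].
  intros s x y x' y' Hx Hy Hx' Hy'.
  replace (K s x' y' - K s x y) with ((K s x' y' - K s x y') + (K s x y' - K s x y)) by ring.
  eapply Rle_trans; [apply Rabs_triang|].
  rewrite Rmult_plus_distr_l. apply Rplus_le_compat.
  - apply (is_derive_Rabs_le (fun x => K s x y') (fun x => K1 s x y')); [auto|].
    intros c Hc. eapply Rle_trans; [apply HM1; [eapply Rabs_between; eauto|auto]|].
    eapply Rle_trans; [apply Rmax_l|apply Rmax_r].
  - apply (is_derive_Rabs_le (fun y => K s x y) (fun y => K2 s x y)); [auto|].
    intros c Hc. eapply Rle_trans; [apply HM2; [auto|eapply Rabs_between; eauto]|].
    eapply Rle_trans; [apply Rmax_r|apply Rmax_r].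
Qed.

Lemma Ck_continuity_2d g : Ck 1 (fun _ => g) -> forall x y, continuity_2d_pt g x y.
Proof.
  intros H x y eps.
  set (r := Rabs x + Rabs y + 1).
  destruct (Ck_lipschitz _ H r) as [M [HM HL]].
  assert (Hd : 0 < Rmin 1 (eps / (2 * (M + 1)))).
  { apply Rmin_pos; [lra|]. apply Rdiv_lt_0_compat; [apply eps|lra]. }
  exists (mkposreal _ Hd). simpl. intros u v Hu Hv.
  pose proof (Rabs_pos x). pose proof (Rabs_pos y).
  assert (Hd1 := Rmin_l 1 (eps / (2 * (M + 1)))).
  assert (Hd2 := Rmin_r 1 (eps / (2 * (M + 1)))).
  eapply Rle_lt_trans.
  - apply (HL 0); unfold r; try lra.
    + replace u with ((u - x) + x) by ring. eapply Rle_trans; [apply Rabs_triang|lra].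
    + replace v with ((v - y) + y) by ring. eapply Rle_trans; [apply Rabs_triang|lra].
  - set (d := eps / (2 * (M + 1))) in *.
    assert (Ed : (M + 1) * (2 * d) = eps) by (unfold d; field; lra).
    assert (0 <= d) by (pose proof (Rabs_pos (u - x)); lra).
    apply Rle_lt_trans with (M * (2 * d)).
    + apply Rmult_le_compat_l; lra.
    + assert (0 < eps) by apply eps. assert (0 < d) by (unfold d; apply Rdiv_lt_0_compat; lra). lra.
Qed.

Lemma is_derive_comp_2d (H H1 H2 : R -> R -> R) (A B : R -> R) (t a b : R) :
  (forall x y, is_derive (fun x' => H x' y) x (H1 x y)) ->
  (forall x y, is_derive (fun y' => H x y') y (H2 x y)) ->
  continuity_2d_pt H1 (A t) (B t) ->
  is_derive A t a -> is_derive B t b ->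
  is_derive (fun t' => H (A t') (B t')) t (H1 (A t) (B t) * a + H2 (A t) (B t) * b).
Proof.
  intros D1 D2 C1 DA DB.
  apply is_derive_Reals. apply derivable_pt_lim_comp_2d; [|now apply is_derive_Reals..].
  apply filterdiff_differentiable_pt_lim.
  apply (is_derive_filterdiff H (A t) (B t) H1 (H2 (A t) (B t))).
  - apply filter_forall. intro u; apply D1.
  - apply D2.
  - apply continuity_2d_pt_filterlim in C1. exact C1.
Qed.

(** The spare order on [H] pays for joint continuity: [Ck 1] makes [H] locally Lipschitz, which
    gives continuity of the composite in [s] and the total differentiability behind the chain
    rule. *)
Lemma Ck_comp n : forall H A B, Ck (S n) (fun _ => H) -> Ck n A -> Ck n B ->
  Ck n (fun s x y => H (A s x y) (B s x y)).
Proof.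
  induction n as [|n IH]; intros H A B HH HA HB;
    pose proof (Ck_bounded _ _ HA) as BA; pose proof (Ck_bounded _ _ HB) as BB;
    pose proof (Ck_continuous _ _ HA) as CA; pose proof (Ck_continuous _ _ HB) as CB;
    pose proof (Ck_bounded _ _ HH) as BH;
    pose proof (Ck_continuity_2d _ (Ck_S_1 _ _ HH)) as CH;
    (split; [intro r; destruct (BA r) as [M1 HM1]; destruct (BB r) as [M2 HM2];
      destruct (BH (Rmax M1 M2)) as [M HM]; exists M; intros s x y Hx Hy;
      apply (HM 0); [eapply Rle_trans; [apply HM1; assumption|apply Rmax_l]|
        eapply Rle_trans; [apply HM2; assumption|apply Rmax_r]]|
    split; [intros s x y;
      apply (continuous_comp_2 (fun s => A s x y) (fun s => B s x y) H); auto;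
      apply continuity_2d_pt_filterlim, CH|]]).
  - exact I.
  - pose proof (Ck_pred _ _ HA) as PA. pose proof (Ck_pred _ _ HB) as PB.
    destruct HA as [_ [_ [A1 [A2 [HA1 [HA2 [CA1 CA2]]]]]]].
    destruct HB as [_ [_ [B1 [B2 [HB1 [HB2 [CB1 CB2]]]]]]].
    destruct HH as [_ [_ [H1 [H2 [HH1 [HH2 [CH1 CH2]]]]]]].
    (* The derivatives supplied by [Ck] may formally depend on the dummy parameter; uniqueness of
       derivatives freezes it at [0], so that the induction hypothesis applies. *)
    assert (CH1' : Ck (S n) (fun _ => H1 0)).
    { apply Ck_ext with H1; [|exact CH1]. intros s x y.
      rewrite <- (is_derive_unique _ _ _ (HH1 s x y)); apply is_derive_unique, HH1. }
    assert (CH2' : Ck (S n) (fun _ => H2 0)).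
    { apply Ck_ext with H2; [|exact CH2]. intros s x y.
      rewrite <- (is_derive_unique _ _ _ (HH2 s x y)); apply is_derive_unique, HH2. }
    assert (CC : forall x y, continuity_2d_pt (H1 0) x y).
    { exact (Ck_continuity_2d _ (Ck_S_1 _ _ CH1')). }
    exists (fun s x y => H1 0 (A s x y) (B s x y) * A1 s x y + H2 0 (A s x y) (B s x y) * B1 s x y),
      (fun s x y => H1 0 (A s x y) (B s x y) * A2 s x y + H2 0 (A s x y) (B s x y) * B2 s x y).
    apply and4_intro; try (apply Ck_plus; apply Ck_mult; [apply IH| |apply IH|]; assumption);
      intros s x y.
    + apply (is_derive_comp_2d H (H1 0) (H2 0) (fun x => A s x y) (fun x => B s x y)); auto.
    + apply (is_derive_comp_2d H (H1 0) (H2 0) (fun y => A s x y) (fun y => B s x y)); auto.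
Qed.

(** * Comparison with smoothness by iterated partial derivatives *)

Lemma Cinf2_Derive g : Cinf2 g ->
  (forall x y, is_derive (fun x' => g x' y) x (Derive (fun x' => g x' y) x)) /\
  (forall x y, is_derive (fun y' => g x y') y (Derive (fun y' => g x y') y)) /\
  Cinf2 (fun x y => Derive (fun x' => g x' y) x) /\
  Cinf2 (fun x y => Derive (fun y' => g x y') y).
Proof.
  intro Hg. apply and4_intro.
  - intros x y. apply Derive_correct.
    destruct (Hg 1%nat) as [_ [_ [K1 [K2 [H1 _]]]]]. exists (K1 0 x y). apply H1.
  - intros x y. apply Derive_correct.
    destruct (Hg 1%nat) as [_ [_ [K1 [K2 [_ [H2 _]]]]]]. exists (K2 0 x y). apply H2.
  - intro n. destruct (Hg (S n)) as [_ [_ [K1 [K2 [H1 [_ [C1 _]]]]]]].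
    apply Ck_ext with K1; [|exact C1]. intros s x y. symmetry. apply is_derive_unique, H1.
  - intro n. destruct (Hg (S n)) as [_ [_ [K1 [K2 [_ [H2 [_ C2]]]]]]].
    apply Ck_ext with K2; [|exact C2]. intros s x y. symmetry. apply is_derive_unique, H2.
Qed.

Lemma Cinf2_smooth2 g : Cinf2 g -> smooth2 g.
Proof.
  intros Hg ds. assert (HD : Cinf2 (pderiv ds g)).
  { induction ds as [|[|] ds IH]; [exact Hg| |]; apply Cinf2_Derive in IH; apply IH. }
  intros x y. destruct (Cinf2_Derive _ HD) as [H1 [H2 _]].
  split; [|split].
  - eexists; apply H1.
  - eexists; apply H2.
  - apply Ck_continuity_2d, (HD 1%nat).
Qed.

(** The gauge [d] is chosen with [d * |g| <= 1] and small enough that [g] varies by less than [1].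
    Compactness bounds the gauge below by [d0] at suitable centres, so [|g| <= / d0] at these
    centres and [|g| <= / d0 + 1] on the whole box. *)
Lemma continuity_2d_bounded g : (forall x y, continuity_2d_pt g x y) ->
  locally_bounded (fun _ => g).
Proof.
  intros Hg r.
  assert (Hd : forall x y, exists d : posreal, d * Rabs (g x y) <= 1 /\
    forall u v, Rabs (u - x) < d -> Rabs (v - y) < d -> Rabs (g u v - g x y) < 1).
  { intros x y. destruct (Hg x y (mkposreal 1 Rlt_0_1)) as [d1 H1].
    pose proof (Rabs_pos (g x y)) as Hp.
    assert (H2 : 0 < Rmin d1 (/ (1 + Rabs (g x y)))).
    { apply Rmin_pos; [apply d1|apply Rinv_0_lt_compat; lra]. }
    exists (mkposreal _ H2). simpl. split.
    - apply Rle_trans with (/ (1 + Rabs (g x y)) * Rabs (g x y)).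
      + apply Rmult_le_compat_r; [exact Hp|apply Rmin_r].
      + apply Rmult_le_reg_l with (1 + Rabs (g x y)); [lra|].
        rewrite <- Rmult_assoc, Rinv_r by lra. lra.
    - intros u v Hu Hv. apply H1; (eapply Rlt_le_trans; [eassumption|apply Rmin_l]). }
  set (d := fun x y => proj1_sig (constructive_indefinite_description _ (Hd x y))).
  assert (Hf : forall x y, d x y * Rabs (g x y) <= 1 /\
    forall u v, Rabs (u - x) < d x y -> Rabs (v - y) < d x y -> Rabs (g u v - g x y) < 1).
  { intros x y. exact (proj2_sig (constructive_indefinite_description _ (Hd x y))). }
  destruct (compactness_value_2d (- r) r (- r) r d) as [d0 H0].
  exists (/ d0 + 1). intros _ x y Hx Hy.
  apply Rabs_le_between in Hx. apply Rabs_le_between in Hy.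
  apply NNPP. intro Hn. apply (H0 x y); [lra|lra|].
  intros [u [v [_ [_ [Hu [Hv Hd0]]]]]]. apply Hn.
  destruct (Hf u v) as [B1 B2]. specialize (B2 x y Hu Hv).
  assert (B3 : Rabs (g u v) <= / d0).
  { pose proof (cond_pos d0). apply Rmult_le_reg_l with d0; [lra|].
    rewrite Rinv_r by lra. pose proof (Rabs_pos (g u v)).
    apply Rle_trans with (d u v * Rabs (g u v)); [apply Rmult_le_compat_r; lra|lra]. }
  replace (g x y) with ((g x y - g u v) + g u v) by ring.
  eapply Rle_trans; [apply Rabs_triang|lra].
Qed.

Lemma smooth2_Cinf2 g : smooth2 g -> Cinf2 g.
Proof.
  intros Hg n. change g with (pderiv nil g). generalize (@nil bool).
  induction n as [|n IH]; intro ds; (split; [|split]);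
    try (apply continuity_2d_bounded; intros; apply Hg); try (intros; apply continuous_const).
  - exact I.
  - exists (fun _ => pderiv (true :: ds) g), (fun _ => pderiv (false :: ds) g).
    apply and4_intro.
    + intros _ x y. exact (Derive_correct _ _ (proj1 (Hg ds x y))).
    + intros _ x y. exact (Derive_correct _ _ (proj1 (proj2 (Hg ds x y)))).
    + exact (IH (true :: ds)).
    + exact (IH (false :: ds)).
Qed.

(** This serves for functions whose derivatives stay in an explicit family: [exp], the combinations
    of [cos] and [sin], and the span of the [exp_inv_neg k]. *)
Lemma Cinf2_of_derivatives (P : (R -> R) -> Prop) :
  (forall f, P f -> exists f', P f' /\ forall x, is_derive f x (f' x)) ->
  forall f, P f -> Cinf2 (fun x _ => f x).
Proof.
  intros HP f Hf n. revert f Hf.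
  induction n as [|n IH]; intros f Hf; destruct (HP f Hf) as [f' [Hf' D]];
    (split; [|split; [intros; apply continuous_const|]]);
    try (apply continuity_2d_bounded; intros x y; apply continuity_2d_pt_filterlim;
      apply (continuous_comp fst f); [apply continuous_fst|];
      apply (ex_derive_continuous (K := R_AbsRing) (V := R_NormedModule)); eexists; apply D).
  - exact I.
  - exists (fun _ x _ => f' x), (fun _ _ _ => 0).
    apply and4_intro; [intros s x y; apply D| |now apply IH|apply Ck_const].
    intros s x y. apply (is_derive_const (f x)).
Qed.

Lemma Cinf2_exp : Cinf2 (fun x _ => exp x).
Proof.
  apply (Cinf2_of_derivatives (fun f => f = exp)); [|reflexivity].
  intros f ->. exists exp. split; [reflexivity|apply is_derive_exp].
Qed.

Lemma Cinf2_cos_sin a b : Cinf2 (fun x _ => a * cos x + b * sin x).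
Proof.
  apply (Cinf2_of_derivatives
    (fun f => exists a b, f = fun x => a * cos x + b * sin x)); [|eauto].
  intros f [a' [b' ->]]. exists (fun x => b' * cos x + (- a') * sin x).
  split; [eauto|]. intro x. auto_derive; [exact I|ring].
Qed.

Lemma Cinf2_comp1 (f : R -> R) n K : Cinf2 (fun x _ => f x) -> Ck n K ->
  Ck n (fun s x y => f (K s x y)).
Proof. intros Hf HK. apply (Ck_comp n (fun x _ => f x) K K); auto. Qed.

Lemma Ck_cos n K : Ck n K -> Ck n (fun s x y => cos (K s x y)).
Proof.
  intro HK. apply (Ck_ext n (fun s x y => 1 * cos (K s x y) + 0 * sin (K s x y)));
    [intros; ring|].
  apply (Cinf2_comp1 (fun t => 1 * cos t + 0 * sin t)); [apply Cinf2_cos_sin|exact HK].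
Qed.

Lemma Ck_sin n K : Ck n K -> Ck n (fun s x y => sin (K s x y)).
Proof.
  intro HK. apply (Ck_ext n (fun s x y => 0 * cos (K s x y) + 1 * sin (K s x y)));
    [intros; ring|].
  apply (Cinf2_comp1 (fun t => 0 * cos t + 1 * sin t)); [apply Cinf2_cos_sin|exact HK].
Qed.

Lemma Ck_exp n K : Ck n K -> Ck n (fun s x y => exp (K s x y)).
Proof. intro HK. apply (Cinf2_comp1 exp); [apply Cinf2_exp|exact HK]. Qed.

(** * A flat function and a smooth replacement for [1 / (1 + x)] *)

Lemma is_derive_0_le (f g : R -> R) x : (forall y, Rabs (g y) <= Rabs (f y)) ->
  f x = 0 -> is_derive f x 0 -> is_derive g x 0.
Proof.
  intros Hle Hfx Hf. assert (Hgx : g x = 0).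
  { specialize (Hle x). rewrite Hfx, Rabs_R0 in Hle.
    apply Rabs_eq_0. pose proof (Rabs_pos (g x)). lra. }
  apply is_derive_Reals. apply is_derive_Reals in Hf.
  intros eps Heps. destruct (Hf eps Heps) as [d Hd]. exists d. intros h Hh Hhd.
  specialize (Hd h Hh Hhd). rewrite Hfx, Rminus_0_r, Rminus_0_r in Hd.
  rewrite Hgx, Rminus_0_r, Rminus_0_r.
  eapply Rle_lt_trans; [|exact Hd].
  unfold Rdiv. rewrite !Rabs_mult. apply Rmult_le_compat_r; [apply Rabs_pos|apply Hle].
Qed.

(** The classical flat function [e^(1/x)] on the negative axis; the negative powers of [x] are those
    that differentiation produces. *)
Definition exp_inv_neg (k : nat) (x : R) : R :=
  if Rlt_dec x 0 then (/ x) ^ k * exp (/ x) else 0.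

Lemma exp_INR_mult n y : exp (INR n * y) = exp y ^ n.
Proof.
  induction n as [|n IH]; [simpl; rewrite Rmult_0_l; apply exp_0|].
  rewrite S_INR, Rmult_plus_distr_r, Rmult_1_l, exp_plus, IH. simpl. ring.
Qed.

(** With [m = S n], this is the [m]-th power of [v / m <= e^(v / m)]. *)
Lemma pow_mult_exp_opp_le n v : 0 <= v -> v ^ S n * exp (- v) <= INR (S n) ^ S n.
Proof.
  intro Hv. pose proof (lt_0_INR (S n) (Nat.lt_0_succ n)) as Hn.
  assert (H : (v / INR (S n)) ^ S n <= exp v).
  { replace v with (INR (S n) * (v / INR (S n))) at 2 by (field; lra).
    rewrite exp_INR_mult. apply pow_incr. split.
    - apply Rmult_le_pos; [exact Hv|left; apply Rinv_0_lt_compat, Hn].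
    - pose proof (exp_ineq1_le (v / INR (S n))). lra. }
  rewrite exp_Ropp. apply Rmult_le_reg_r with (exp v); [apply exp_pos|].
  rewrite Rmult_assoc, Rinv_l by (apply Rgt_not_eq, exp_pos). rewrite Rmult_1_r.
  apply Rle_trans with (INR (S n) ^ S n * (v / INR (S n)) ^ S n).
  - rewrite <- Rpow_mult_distr. right. f_equal. field. lra.
  - apply Rmult_le_compat_l; [apply pow_le; lra|exact H].
Qed.

(** With [v = - 1 / x], two extra powers of [v] are absorbed by the exponential and leave [x ^ 2]. A
    quadratic bound suffices: it forces the derivative at [0] to vanish, and every derivative is
    again a combination of such functions. *)
Lemma exp_inv_neg_le k x : Rabs (exp_inv_neg k x) <= Rabs (INR (S (S k)) ^ S (S k) * x ^ 2).
Proof.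
  unfold exp_inv_neg. destruct (Rlt_dec x 0) as [Hx|Hx].
  - assert (Hi : 0 < / - x) by (apply Rinv_0_lt_compat; lra).
    assert (H := pow_mult_exp_opp_le (S k) (/ - x) (Rlt_le _ _ Hi)).
    replace (/ x) with (- / - x) by (field; lra).
    set (v := / - x) in *.
    assert (E : x ^ 2 * v ^ 2 = 1) by (unfold v; field; lra).
    rewrite Rabs_mult, <- RPow_abs, Rabs_Ropp, (Rabs_pos_eq v) by lra.
    rewrite (Rabs_pos_eq (exp _)) by (left; apply exp_pos).
    rewrite Rabs_pos_eq by (apply Rmult_le_pos; [apply pow_le, pos_INR|apply pow2_ge_0]).
    replace (v ^ k * exp (- v)) with (v ^ S (S k) * exp (- v) * x ^ 2).
    + apply Rmult_le_compat_r; [apply pow2_ge_0|exact H].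
    + change (v ^ S (S k)) with (v * (v * v ^ k)).
      replace (v * (v * v ^ k) * exp (- v) * x ^ 2) with
        ((x ^ 2 * v ^ 2) * (v ^ k * exp (- v))) by ring. rewrite E. ring.
  - rewrite Rabs_R0. apply Rabs_pos.
Qed.

Lemma is_derive_exp_inv_neg k x : is_derive (exp_inv_neg k) x
  (- INR k * exp_inv_neg (S k) x - exp_inv_neg (S (S k)) x).
Proof.
  destruct (total_order_T x 0) as [[Hx|Hx]|Hx].
  - apply is_derive_ext_loc with (fun x => (/ x) ^ k * exp (/ x)).
    + exists (mkposreal (- x) ltac:(lra)). intros y Hy. simpl in Hy.
      apply Rabs_lt_between in Hy. unfold minus, plus, opp in Hy. simpl in Hy.
      unfold exp_inv_neg. destruct (Rlt_dec y 0); [reflexivity|lra].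
    + unfold exp_inv_neg. destruct (Rlt_dec x 0); [|lra].
      auto_derive; [lra|]. destruct k as [|k]; simpl pred.
      * simpl. field. lra.
      * change ((/ x) ^ S (S k)) with (/ x * (/ x * (/ x) ^ k)).
        change ((/ x) ^ S (S (S k))) with (/ x * (/ x * (/ x * (/ x) ^ k))).
        change ((/ x) ^ S k) with (/ x * (/ x) ^ k). 
        set (p := (/ x) ^ k). field. lra.
  - subst x. replace (_ - _) with 0.
    + apply is_derive_0_le with (fun x => INR (S (S k)) ^ S (S k) * x ^ 2).
      * apply exp_inv_neg_le.
      * ring.
      * auto_derive; [exact I|]. ring.
    + unfold exp_inv_neg. destruct (Rlt_dec 0 0); lra.
  - apply is_derive_ext_loc with (fun _ => 0).
    + exists (mkposreal x Hx). intros y Hy. simpl in Hy.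
      apply Rabs_lt_between in Hy. unfold minus, plus, opp in Hy. simpl in Hy.
      unfold exp_inv_neg. destruct (Rlt_dec y 0); [lra|reflexivity].
    + replace (_ - _) with 0.
      * apply (is_derive_const 0).
      * unfold exp_inv_neg. destruct (Rlt_dec x 0); lra.
Qed.

Inductive exp_inv_neg_span : (R -> R) -> Prop :=
| span_gen k : exp_inv_neg_span (exp_inv_neg k)
| span_lin a b f g : exp_inv_neg_span f -> exp_inv_neg_span g ->
    exp_inv_neg_span (fun x => a * f x + b * g x).

Lemma Cinf2_exp_inv_neg k : Cinf2 (fun x _ => exp_inv_neg k x).
Proof.
  apply (Cinf2_of_derivatives exp_inv_neg_span); [|constructor].
  intros f Hf. induction Hf as [k'|a b f g Hf [f' [Hf' Df]] Hg [g' [Hg' Dg]]].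
  - exists (fun x => - INR k' * exp_inv_neg (S k') x + -1 * exp_inv_neg (S (S k')) x).
    split; [repeat constructor|]. intro x.
    replace (_ + _) with (- INR k' * exp_inv_neg (S k') x - exp_inv_neg (S (S k')) x) by ring.
    apply is_derive_exp_inv_neg.
  - exists (fun x => a * f' x + b * g' x). split; [now constructor|]. intro x.
    apply (is_derive_plus (fun x => a * f x) (fun x => b * g x));
      apply (is_derive_scal _ x); auto.
Qed.

(** The flat term removes the pole of [1 / (1 + x)] at [-1] and vanishes for [x >= -1/2]. *)
Definition inv_ext (x : R) : R := / (1 + x + exp_inv_neg 0 (x + / 2)).

Lemma inv_ext_eq x : - / 2 <= x -> inv_ext x = / (1 + x).
Proof.
  intro Hx. unfold inv_ext, exp_inv_neg. destruct (Rlt_dec (x + / 2) 0); [lra|].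
  f_equal. ring.
Qed.

Lemma inv_ext_den_ge x : -1 <= x -> Rmin (/ 4) (exp (-4)) <= 1 + x + exp_inv_neg 0 (x + / 2).
Proof.
  intro Hx. unfold exp_inv_neg. destruct (Rlt_dec (x + / 2) 0) as [H|H].
  (* For [x >= -3/4] the summand [1 + x] is already at least [1/4]; below that, [x + 1/2 < -1/4], so
     the exponential is at least [e^(-4)]. *)
  - rewrite pow_O, Rmult_1_l. destruct (Rle_dec (- 3 / 4) x) as [H'|H'].
    + pose proof (exp_pos (/ (x + / 2))). eapply Rle_trans; [apply Rmin_l|lra].
    + eapply Rle_trans; [apply Rmin_r|].
      apply Rle_trans with (exp (/ (x + / 2))); [|lra].
      assert (Hi : -4 <= / (x + / 2)).
      { replace (/ (x + / 2)) with (- / - (x + / 2)) by (field; lra).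
        assert (/ - (x + / 2) <= / / 4) by (apply Rinv_le_contravar; lra).
        rewrite Rinv_inv in *. lra. }
      destruct Hi as [Hi| <-]; [left; now apply exp_increasing|lra].
  - eapply Rle_trans; [apply Rmin_l|lra].
Qed.

Lemma Ck_inv_ext n K : (forall s x y, -1 <= K s x y) -> Ck n K ->
  Ck n (fun s x y => inv_ext (K s x y)).
Proof.
  intros H HK. apply (Ck_inv n (Rmin (/ 4) (exp (-4)))).
  - apply Rmin_pos; [lra|apply exp_pos].
  - intros; now apply inv_ext_den_ge.
  - apply (Ck_plus n (fun s x y => 1 + K s x y)).
    + apply Ck_plus; [apply Ck_const|exact HK].
    + apply (Cinf2_comp1 (exp_inv_neg 0)); [apply Cinf2_exp_inv_neg|].
      apply Ck_plus; [exact HK|apply Ck_const].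
Qed.

(** * Exponentially weighted integrals over the line *)

Definition exp_decay (p M : R) (f : R -> R) : Prop :=
  (forall s, continuous f s) /\ forall s, Rabs (f s) <= M * exp (- p * Rabs s).

(** A limit along the integers is total in [f]. Under exponential decay, [half_int_tail] identifies
    it with the improper integral and gives the rate of convergence. *)
Definition half_int (f : R -> R) : R := real (Lim_seq (fun n => RInt f 0 (INR n))).

Definition line_int (f : R -> R) : R := half_int f + half_int (fun s => f (- s)).

Lemma exp_decay_opp p M f : exp_decay p M f -> exp_decay p M (fun s => f (- s)).
Proof.
  intros [Hc Hb]. split.
  - intro s. apply (continuous_comp Ropp f); [|apply Hc].
    apply (continuous_opp (fun s : R => s)), continuous_id.
  - intro s. rewrite <- (Rabs_Ropp s). apply Hb.
Qed.

Lemma exp_decay_ex_RInt p M f a b : exp_decay p M f -> ex_RInt f a b.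
Proof. intros [Hc _]. apply (ex_RInt_continuous (V := R_CompleteNormedModule)); auto. Qed.

Lemma exp_decay_RInt_le p M f b b' : 0 < p -> exp_decay p M f -> 0 <= b <= b' ->
  Rabs (RInt f b b') <= M / p * exp (- p * b).
Proof.
  intros Hp Hf Hb. pose proof (exp_decay_ex_RInt _ _ _ b b' Hf) as Ex.
  destruct Hf as [Hc Hd].
  assert (HM : 0 <= M).
  { specialize (Hd 0). rewrite Rabs_R0, Rmult_0_r, exp_0 in Hd.
    pose proof (Rabs_pos (f 0)). lra. }
  set (A := fun s => - (M / p) * exp (- p * s)).
  assert (HA : is_RInt (fun s => M * exp (- p * s)) b b' (minus (A b') (A b))).
  { apply (is_RInt_derive (V := R_CompleteNormedModule)).
    - intros s _. unfold A. auto_derive; [exact I|]. field. lra.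
    - intros s _. apply (ex_derive_continuous (K := R_AbsRing) (V := R_NormedModule)).
      auto_derive. exact I. }
  apply Rle_trans with (minus (A b') (A b)).
  - apply (norm_RInt_le f (fun s => M * exp (- p * s)) b b'); [lra| |
      now apply (RInt_correct (V := R_CompleteNormedModule))|exact HA].
    intros s Hs. specialize (Hd s). rewrite (Rabs_pos_eq s) in Hd by lra. exact Hd.
  - unfold minus, plus, opp, A; simpl.
    assert (0 <= M / p * exp (- p * b')); [|lra].
    apply Rmult_le_pos; [apply Rmult_le_pos; [exact HM|left; now apply Rinv_0_lt_compat]|
      left; apply exp_pos].
Qed.

Lemma half_int_tail p M f : 0 < p -> exp_decay p M f -> forall b, 0 <= b ->
  Rabs (half_int f - RInt f 0 b) <= M / p * exp (- p * b).
Proof.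
  intros Hp Hf.
  assert (Diff : forall b b', RInt f 0 b' - RInt f 0 b = RInt f b b').
  { intros b b'. rewrite <- (RInt_Chasles (V := R_CompleteNormedModule) f 0 b b')
      by (eapply exp_decay_ex_RInt; eassumption).
    unfold plus; simpl. ring. }
  assert (HM : 0 <= M).
  { destruct Hf as [_ Hd]. specialize (Hd 0). rewrite Rabs_R0, Rmult_0_r, exp_0 in Hd.
    pose proof (Rabs_pos (f 0)). lra. }
  assert (Hz : is_lim_seq (fun n => M / p * exp (- p * INR n)) 0).
  { replace (Finite 0) with (Rbar_mult (M / p) 0) by (simpl; f_equal; ring).
    apply is_lim_seq_scal_l.
    apply (is_lim_comp_seq exp (fun n => - p * INR n) m_infty 0); [apply is_lim_exp_m| |].
    - exists O. discriminate.
    - replace m_infty with (Rbar_mult (- p) p_infty).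
      + apply is_lim_seq_scal_l, is_lim_seq_INR.
      + simpl. destruct (Rle_dec 0 (- p)); [exfalso; lra|reflexivity]. }
  assert (HL : is_lim_seq (fun n => RInt f 0 (INR n)) (half_int f)).
  { apply Lim_seq_correct', ex_lim_seq_cauchy_corr. intro eps.
    apply is_lim_seq_spec in Hz. destruct (Hz eps) as [N HN]. exists N.
    assert (W : forall n m, (N <= n)%nat -> (n <= m)%nat ->
      Rabs (RInt f 0 (INR m) - RInt f 0 (INR n)) < eps).
    { intros n m Hn Hm. rewrite Diff. eapply Rle_lt_trans.
      - apply (exp_decay_RInt_le p M); auto. split; [apply pos_INR|now apply le_INR].
      - specialize (HN n Hn). rewrite Rminus_0_r in HN. eapply Rle_lt_trans; [|exact HN].
        apply Rle_abs. }
    intros n m Hn Hm. destruct (Nat.le_ge_cases n m).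
    - rewrite Rabs_minus_sym. now apply W.
    - now apply W. }
  intros b Hb.
  apply (is_lim_seq_le_loc (fun n => Rabs (RInt f 0 (INR n) - RInt f 0 b))
    (fun _ => M / p * exp (- p * b)) (Rabs (half_int f - RInt f 0 b)) (M / p * exp (- p * b))).
  - destruct (nfloor_ex b Hb) as [N HN]. exists (S N). intros n Hn. rewrite Diff.
    apply exp_decay_RInt_le; auto. split; [exact Hb|].
    apply le_INR in Hn. rewrite S_INR in Hn. lra.
  - apply (is_lim_seq_abs (fun n => RInt f 0 (INR n) - RInt f 0 b) (Finite _)).
    apply is_lim_seq_minus'; [exact HL|apply is_lim_seq_const].
  - apply is_lim_seq_const.
Qed.

Lemma eq_of_exp_tail p C l l' : 0 < p ->
  (forall b, 0 <= b -> Rabs (l - l') <= C * exp (- p * b)) -> l = l'.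
Proof.
  intros Hp H. apply Rminus_diag_uniq, Rabs_eq_0.
  destruct (Req_dec (Rabs (l - l')) 0) as [E|E]; [exact E|exfalso].
  pose proof (Rabs_pos (l - l')) as Hr. set (r := Rabs (l - l')) in *.
  assert (HC : 0 < C).
  { specialize (H 0 (Rle_refl 0)). rewrite Rmult_0_r, exp_0 in H. lra. }
  (* At [b = C / (r p)] the hypothesis reads [r * exp (C / r) <= C], which contradicts
     [exp y >= 1 + y]. *)
  assert (Hb : 0 <= C / r / p).
  { apply Rmult_le_pos; [apply Rmult_le_pos|]; try (left; apply Rinv_0_lt_compat); lra. }
  specialize (H _ Hb). replace (- p * (C / r / p)) with (- (C / r)) in H by (field; lra).
  rewrite exp_Ropp in H. pose proof (exp_ineq1_le (C / r)) as He.
  apply (Rmult_le_compat_r (exp (C / r))) in H; [|left; apply exp_pos].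
  rewrite Rmult_assoc, Rinv_l, Rmult_1_r in H by (apply Rgt_not_eq, exp_pos).
  apply (Rmult_le_compat_l r) in He; [|exact Hr].
  replace (r * (1 + C / r)) with (r + C) in He by (field; lra). lra.
Qed.

(** Both sides differ from the same integral over [[0, t]] by an exponentially small error, for
    every [t >= 0]. *)
Lemma half_int_lin p M N f g a b : 0 < p -> exp_decay p M f -> exp_decay p N g ->
  half_int (fun s => a * f s + b * g s) = a * half_int f + b * half_int g.
Proof.
  intros Hp Hf Hg.
  assert (Hfg : exp_decay p (Rabs a * M + Rabs b * N) (fun s => a * f s + b * g s)).
  { split.
    - intro s. apply (continuous_plus (fun s => a * f s) (fun s => b * g s)).
      + apply (continuous_scal_r a f), Hf.
      + apply (continuous_scal_r b g), Hg.
    - intro s. eapply Rle_trans; [apply Rabs_triang|]. rewrite !Rabs_mult, Rmult_plus_distr_r.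
      apply Rplus_le_compat; rewrite Rmult_assoc; apply Rmult_le_compat_l;
        try apply Rabs_pos; [apply Hf|apply Hg]. }
  apply (eq_of_exp_tail p ((Rabs a * M + Rabs b * N) / p + Rabs a * (M / p) + Rabs b * (N / p)));
    [exact Hp|].
  intros t Ht.
  pose proof (half_int_tail _ _ _ Hp Hf t Ht) as Tf.
  pose proof (half_int_tail _ _ _ Hp Hg t Ht) as Tg.
  pose proof (half_int_tail _ _ _ Hp Hfg t Ht) as Tfg.
  assert (E : RInt (fun s => a * f s + b * g s) 0 t = a * RInt f 0 t + b * RInt g 0 t).
  { apply is_RInt_unique.
    apply (is_RInt_plus (V := R_NormedModule) (fun s => a * f s) (fun s => b * g s));
      apply (is_RInt_scal (V := R_NormedModule));
      apply (RInt_correct (V := R_CompleteNormedModule)); eapply exp_decay_ex_RInt; eassumption. }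
  rewrite E in Tfg.
  set (h := half_int (fun s => a * f s + b * g s)) in *.
  replace (h - (a * half_int f + b * half_int g)) with
    ((h - (a * RInt f 0 t + b * RInt g 0 t)) - a * (half_int f - RInt f 0 t)
      - b * (half_int g - RInt g 0 t)) by ring.
  apply (Rmult_le_compat_l (Rabs a)) in Tf; [|apply Rabs_pos].
  apply (Rmult_le_compat_l (Rabs b)) in Tg; [|apply Rabs_pos].
  rewrite <- Rabs_mult in Tf, Tg.
  unfold Rminus at 1 2. eapply Rle_trans; [apply Rabs_triang|].
  rewrite Rabs_Ropp.
  eapply Rle_trans; [apply Rplus_le_compat_r, Rabs_triang|]. rewrite Rabs_Ropp.
  lra.
Qed.

Lemma line_int_lin p M N f g a b : 0 < p -> exp_decay p M f -> exp_decay p N g ->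
  line_int (fun s => a * f s + b * g s) = a * line_int f + b * line_int g.
Proof.
  intros Hp Hf Hg. unfold line_int.
  rewrite (half_int_lin p M N f g), (half_int_lin p M N (fun s => f (- s)) (fun s => g (- s)));
    auto using exp_decay_opp. ring.
Qed.

Lemma line_int_opp f : line_int (fun s => f (- s)) = line_int f.
Proof.
  unfold line_int. rewrite Rplus_comm. f_equal. f_equal.
  apply functional_extensionality. intro s. now rewrite Ropp_involutive.
Qed.

Lemma line_int_le p M f : 0 < p -> exp_decay p M f -> Rabs (line_int f) <= 2 * M / p.
Proof.
  intros Hp Hf. unfold line_int. eapply Rle_trans; [apply Rabs_triang|].
  pose proof (half_int_tail _ _ _ Hp Hf 0 (Rle_refl 0)) as T1.
  pose proof (half_int_tail _ _ _ Hp (exp_decay_opp _ _ _ Hf) 0 (Rle_refl 0)) as T2.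
  rewrite RInt_point, Rmult_0_r, exp_0 in T1, T2. unfold zero in T1, T2; simpl in T1, T2.
  rewrite Rminus_0_r in T1, T2. lra.
Qed.

Lemma line_int_RInt p M f : 0 < p -> exp_decay p M f -> forall a b, a <= 0 <= b ->
  Rabs (line_int f - RInt f a b) <= M / p * (exp (p * a) + exp (- p * b)).
Proof.
  intros Hp Hf a b Hab.
  pose proof (half_int_tail _ _ _ Hp Hf b (proj2 Hab)) as T1.
  assert (Ha : 0 <= - a) by lra.
  pose proof (half_int_tail _ _ _ Hp (exp_decay_opp _ _ _ Hf) (- a) Ha) as T2.
  rewrite <- (RInt_Chasles (V := R_CompleteNormedModule) f a 0 b)
    by (eapply exp_decay_ex_RInt; eassumption).
  assert (E : RInt f a 0 = RInt (fun s => f (- s)) 0 (- a)).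
  { pose proof (exp_decay_ex_RInt _ _ _ 0 a Hf) as Ex.
    rewrite <- (opp_RInt_swap (V := R_CompleteNormedModule) f 0 a Ex).
    symmetry. apply is_RInt_unique.
    apply (is_RInt_ext (fun s => opp (opp (f (- s))))); [intros; apply opp_opp|].
    apply (is_RInt_opp (V := R_NormedModule) (fun s => opp (f (- s)))).
    apply (is_RInt_comp_opp (V := R_NormedModule) f). rewrite Ropp_involutive, Ropp_0.
    now apply (RInt_correct (V := R_CompleteNormedModule)). }
  rewrite E. unfold line_int, plus; simpl.
  replace (- p * - a) with (p * a) in T2 by ring.
  set (X := half_int f) in *. set (Y := half_int (fun s => f (- s))) in *.
  set (X' := RInt f 0 b) in *. set (Y' := RInt (fun s => f (- s)) 0 (- a)) in *.
  replace (X + Y - (Y' + X')) with ((X - X') + (Y - Y')) by ring.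
  eapply Rle_trans; [apply Rabs_triang|]. lra.
Qed.

Lemma is_derive_quadratic (F : R -> R) x l C :
  (forall h, Rabs h <= 1 -> Rabs (F (x + h) - F x - h * l) <= C * h ^ 2) -> is_derive F x l.
Proof.
  intro H. apply is_derive_Reals. intros eps Heps.
  assert (HC : 0 <= C).
  { specialize (H 1). rewrite Rabs_R1, pow1, Rmult_1_r in H.
    eapply Rle_trans; [|apply H; lra]. apply Rabs_pos. }
  assert (Hd : 0 < Rmin 1 (eps / (C + 1))).
  { apply Rmin_pos; [lra|apply Rdiv_lt_0_compat; lra]. }
  exists (mkposreal _ Hd). simpl. intros h Hh Hhd.
  pose proof (Rmin_l 1 (eps / (C + 1))). pose proof (Rmin_r 1 (eps / (C + 1))).
  replace ((F (x + h) - F x) / h - l) with ((F (x + h) - F x - h * l) / h) by (field; auto).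
  pose proof (Rabs_pos_lt _ Hh) as Hh'.
  unfold Rdiv. rewrite Rabs_mult, Rabs_inv.
  apply Rle_lt_trans with (C * h ^ 2 * / Rabs h).
  - apply Rmult_le_compat_r; [left; now apply Rinv_0_lt_compat|apply H; lra].
  - rewrite <- pow2_abs. replace (C * Rabs h ^ 2 * / Rabs h) with (C * Rabs h) by (field; lra).
    apply Rle_lt_trans with (C * (eps / (C + 1))).
    + apply Rmult_le_compat_l; lra.
    + assert (E : (C + 1) * (eps / (C + 1)) = eps) by (field; lra).
      assert (0 < eps / (C + 1)) by (apply Rdiv_lt_0_compat; lra). lra.
Qed.

Lemma is_derive_lipschitz_remainder (f df : R -> R) x h M :
  (forall y, is_derive f y (df y)) ->
  (forall y, Rabs (y - x) <= Rabs h -> Rabs (df y - df x) <= M * Rabs (y - x)) -> 0 <= M ->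
  Rabs (f (x + h) - f x - h * df x) <= M * h ^ 2.
Proof.
  intros D HM HM0.
  replace (f (x + h) - f x - h * df x) with
    ((f (x + h) - (x + h) * df x) - (f x - x * df x)) by ring.
  replace (M * h ^ 2) with (M * Rabs h * Rabs (x + h - x))
    by (rewrite <- pow2_abs; replace (x + h - x) with h by ring; ring).
  apply (is_derive_Rabs_le (fun y => f y - y * df x) (fun y => df y - df x)).
  - intro y. apply (is_derive_minus f (fun y => y * df x)); [apply D|].
    auto_derive; [exact I|ring].
  - intros y Hy.
    assert (Hyx : Rabs (y - x) <= Rabs h).
    { unfold Rabs, Rmin, Rmax in *.
      destruct (Rle_dec x (x + h)); destruct (Rcase_abs (y - x)); destruct (Rcase_abs h); lra. }
    eapply Rle_trans; [apply HM, Hyx|]. now apply Rmult_le_compat_l.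
Qed.

Lemma exp_decay_mult p c w k M : exp_decay p c w ->
  (forall s, continuous k s) -> (forall s, Rabs (k s) <= M) ->
  exp_decay p (c * M) (fun s => w s * k s).
Proof.
  intros Hw Hk HM. split.
  - intro s. apply (continuous_mult w k); [apply Hw|apply Hk].
  - intro s. rewrite Rabs_mult.
    replace (c * M * exp (- p * Rabs s)) with (c * exp (- p * Rabs s) * M) by ring.
    apply Rmult_le_compat; auto using Rabs_pos. apply Hw.
Qed.

(** A Taylor remainder passes through the functional when it is bounded uniformly in [s]. With
    [h = 0] the same bound compares the integrals of two nearby kernels. *)
Lemma weighted_remainder (p c : R) (w : R -> R) (p_pos : 0 < p) (w_decay : exp_decay p c w)
  (k k' k1 : R -> R) (M M' M1 C h : R) :
  (forall s, continuous k s) -> (forall s, continuous k' s) -> (forall s, continuous k1 s) ->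
  (forall s, Rabs (k s) <= M) -> (forall s, Rabs (k' s) <= M') -> (forall s, Rabs (k1 s) <= M1) ->
  (forall s, Rabs (k' s - k s - h * k1 s) <= C) ->
  Rabs (line_int (fun s => w s * k' s) - line_int (fun s => w s * k s)
    - h * line_int (fun s => w s * k1 s)) <= 2 * (c * C) / p.
Proof.
  intros Ck Ck' Ck1 Bk Bk' Bk1 HC.
  pose proof (exp_decay_mult p c w k M w_decay Ck Bk) as D.
  pose proof (exp_decay_mult p c w k' M' w_decay Ck' Bk') as D'.
  pose proof (exp_decay_mult p c w k1 M1 w_decay Ck1 Bk1) as D1.
  assert (Ck2 : forall s, continuous (fun s => k' s - k s) s).
  { intro s. apply (continuous_minus k' k); auto. }
  assert (D2 : exp_decay p (c * (M' + M)) (fun s => w s * (k' s - k s))).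
  { apply exp_decay_mult; [exact w_decay|exact Ck2|].
    intro s. unfold Rminus. eapply Rle_trans; [apply Rabs_triang|]. rewrite Rabs_Ropp.
    apply Rplus_le_compat; auto. }
  assert (E1 : line_int (fun s => w s * (k' s - k s)) =
    1 * line_int (fun s => w s * k' s) + -1 * line_int (fun s => w s * k s)).
  { rewrite <- (line_int_lin p (c * M') (c * M)) by auto.
    f_equal. apply functional_extensionality; intro s; ring. }
  assert (E2 : line_int (fun s => w s * (k' s - k s - h * k1 s)) =
    1 * line_int (fun s => w s * (k' s - k s)) + - h * line_int (fun s => w s * k1 s)).
  { rewrite <- (line_int_lin p (c * (M' + M)) (c * M1)) by auto.
    f_equal. apply functional_extensionality; intro s; ring. }
  replace (_ - _ - _) with (line_int (fun s => w s * (k' s - k s - h * k1 s)))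
    by (rewrite E2, E1; ring).
  apply line_int_le; [exact p_pos|]. apply exp_decay_mult; [exact w_decay| |exact HC].
  intro s. apply (continuous_minus (fun s => k' s - k s) (fun s => h * k1 s)); auto.
  apply (continuous_scal_r h k1), Ck1.
Qed.

(* Differentiation under the integral only uses that [line_int] is a bounded linear
   functional: the second derivatives bound the Taylor remainder uniformly in [s]. *)
Lemma Ck_line_int (p c : R) (w : R -> R) (p_pos : 0 < p) (w_decay : exp_decay p c w) n :
  forall K, Ck (S n) K ->
  Ck n (fun _ x y => line_int (fun s => w s * K s x y)).
Proof.
  induction n as [|n IH]; intros K HK;
    (assert (HB : locally_bounded (fun _ x y => line_int (fun s => w s * K s x y)));
     [intro r; destruct (Ck_bounded _ _ HK r) as [M HM]; exists (2 * (c * M) / p);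
      intros _ x y Hx Hy; apply line_int_le; [exact p_pos|];
      apply exp_decay_mult;
        [exact w_decay|intro s; apply (Ck_continuous _ _ HK)|intro s; now apply HM]|]);
    (split; [exact HB|split; [intros; apply continuous_const|]]).
  - exact I.
  - assert (BK := Ck_bounded _ _ HK). assert (CK := Ck_continuous _ _ HK).
    destruct HK as [_ [_ [K1 [K2 [D1 [D2 [C1 C2]]]]]]].
    assert (BK1 := Ck_bounded _ _ C1). assert (CK1 := Ck_continuous _ _ C1).
    assert (BK2 := Ck_bounded _ _ C2). assert (CK2 := Ck_continuous _ _ C2).
    exists (fun _ x y => line_int (fun s => w s * K1 s x y)),
      (fun _ x y => line_int (fun s => w s * K2 s x y)).
    apply and4_intro; [| |now apply IH|now apply IH]; intros _ x y;
      set (r := Rabs x + Rabs y + 1);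
      destruct (BK r) as [M HM]; destruct (BK1 r) as [M1 HM1]; destruct (BK2 r) as [M2 HM2];
      destruct (Ck_lipschitz _ (Ck_S_1 _ _ C1) r) as [L1 [HL1 Lip1]];
      destruct (Ck_lipschitz _ (Ck_S_1 _ _ C2) r) as [L2 [HL2 Lip2]];
      pose proof (Rabs_pos x) as Px; pose proof (Rabs_pos y) as Py;
      (assert (Rx : Rabs x <= r) by (unfold r; lra));
      (assert (Ry : Rabs y <= r) by (unfold r; lra)).
    + apply is_derive_quadratic with (2 * (c * L1) / p). intros h Hh.
      replace (2 * (c * L1) / p * h ^ 2) with (2 * (c * (L1 * h ^ 2)) / p) by (field; lra).
      assert (Rh : Rabs (x + h) <= r) by (eapply Rle_trans; [apply Rabs_triang|unfold r; lra]).
      apply (weighted_remainder p c w p_pos w_decay _ _ _ M M M1); auto.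
      intro s. apply (is_derive_lipschitz_remainder (fun x => K s x y) (fun x => K1 s x y)); auto.
      intros z Hz. assert (Rz : Rabs z <= r).
      { replace z with (z - x + x) by ring. eapply Rle_trans; [apply Rabs_triang|unfold r; lra]. }
      specialize (Lip1 s x y z y Rx Ry Rz Ry).
      rewrite Rminus_diag, Rabs_R0, Rplus_0_r in Lip1. exact Lip1.
    + apply is_derive_quadratic with (2 * (c * L2) / p). intros h Hh.
      replace (2 * (c * L2) / p * h ^ 2) with (2 * (c * (L2 * h ^ 2)) / p) by (field; lra).
      assert (Rh : Rabs (y + h) <= r) by (eapply Rle_trans; [apply Rabs_triang|unfold r; lra]).
      apply (weighted_remainder p c w p_pos w_decay _ _ _ M M M2); auto.
      intro s. apply (is_derive_lipschitz_remainder (fun y => K s x y) (fun y => K2 s x y)); auto.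
      intros z Hz. assert (Rz : Rabs z <= r).
      { replace z with (z - y + y) by ring. eapply Rle_trans; [apply Rabs_triang|unfold r; lra]. }
      specialize (Lip2 s x y x z Rx Ry Rx Rz).
      rewrite Rminus_diag, Rabs_R0, Rplus_0_l in Lip2. exact Lip2.
Qed.

(** * Flat functions *)

(** Vanishing to infinite order along the lines [cos y = 0], asked of the values of [W] alone;
    [flat_Derive] carries it over to the derivatives. *)
Definition flat (W : R -> R -> R) : Prop := Cinf2 W /\
  forall N r, exists C, 0 <= C /\
    forall x y, Rabs x <= r -> Rabs y <= r -> Rabs (W x y) <= C * Rabs (cos y) ^ N.

(* Landau-Kolmogorov interpolation: choose the step [h = d ^ N] in
   [h |f'| <= |f (t + h)| + |f t| + L h^2]. *)
Lemma derive_le_interpolation (f : R -> R) (t l d C L : R) (N : nat) :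
  (forall h, 0 <= h <= 1 -> Rabs (f (t + h) - f t - h * l) <= L * h ^ 2) ->
  0 <= d <= 1 -> 0 <= C -> 0 <= L ->
  (forall h, 0 <= h <= 1 -> Rabs (f (t + h)) <= C * (d + h) ^ (2 * S N)) ->
  Rabs l <= (C * 2 ^ (2 * S N) + C + L) * d ^ S N.
Proof.
  intros HL Hd HC HL0 Hf.
  assert (Key : forall h, 0 <= h <= 1 ->
    h * Rabs l <= C * (d + h) ^ (2 * S N) + C * d ^ (2 * S N) + L * h ^ 2).
  { intros h Hh. pose proof (Hf h Hh) as F1. pose proof (Hf 0 ltac:(lra)) as F0.
    rewrite !Rplus_0_r in F0. specialize (HL h Hh).
    rewrite <- (Rabs_pos_eq h) at 1 by lra. rewrite <- Rabs_mult.
    replace (h * l) with (f (t + h) - f t - (f (t + h) - f t - h * l)) by ring.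
    unfold Rminus at 1 2. eapply Rle_trans; [apply Rabs_triang|]. rewrite Rabs_Ropp.
    eapply Rle_trans; [apply Rplus_le_compat_r, Rabs_triang|]. rewrite Rabs_Ropp. lra. }
  (* The step [d ^ S N] degenerates when [d = 0]. There every small [h > 0] gives
     [|l| <= (C + L) * h], and the chosen [h] makes the right side less than [|l| / 2], so
     [l = 0]. *)
  destruct (Req_dec d 0) as [->|Hd0].
  - rewrite pow_i, Rmult_0_r by lia.
    apply Rle_trans with 0; [|lra].
    apply Rnot_lt_le. intro Hl.
    set (h := Rmin 1 (Rabs l / (C + L + 1) / 2)).
    assert (0 < Rabs l / (C + L + 1) / 2) by (repeat apply Rdiv_lt_0_compat; lra).
    assert (Hh : 0 < h <= 1) by (split; [apply Rmin_pos; lra|apply Rmin_l]).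
    assert (Hh2 : h <= Rabs l / (C + L + 1) / 2) by apply Rmin_r.
    specialize (Key h ltac:(lra)). rewrite Rplus_0_l, pow_i, Rmult_0_r, Rplus_0_r in Key by lia.
    assert (Hp : h ^ (2 * S N) <= h ^ 2).
    { replace (2 * S N)%nat with (2 + 2 * N)%nat by lia. rewrite pow_add.
      assert (h ^ (2 * N) <= 1 ^ (2 * N)) by (apply pow_incr; lra). rewrite pow1 in *.
      pose proof (pow2_ge_0 h). nra. }
    assert (Hk : h * Rabs l <= h * ((C + L) * h)).
    { eapply Rle_trans; [exact Key|].
      apply (Rmult_le_compat_l C) in Hp; [|lra]. lra. }
    apply Rmult_le_reg_l in Hk; [|lra].
    assert ((C + L + 1) * h <= Rabs l / 2).
    { replace (Rabs l / 2) with ((C + L + 1) * (Rabs l / (C + L + 1) / 2)) by (field; lra).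
      apply Rmult_le_compat_l; lra. }
    lra.
  - set (h := d ^ S N) in *.
    assert (Hh : 0 < h) by (apply pow_lt; lra).
    assert (Hhd : h <= d).
    { unfold h. simpl. assert (d ^ N <= 1 ^ N) by (apply pow_incr; lra). rewrite pow1 in *. nra. }
    assert (E : d ^ (2 * S N) = h ^ 2).
    { unfold h. rewrite <- pow_mult. f_equal. lia. }
    specialize (Key h ltac:(lra)). rewrite E in Key.
    assert (Hp : (d + h) ^ (2 * S N) <= 2 ^ (2 * S N) * h ^ 2).
    { rewrite <- E, <- Rpow_mult_distr. apply pow_incr. lra. }
    apply Rmult_le_reg_l with h; [exact Hh|].
    apply (Rmult_le_compat_l C) in Hp; [|exact HC].
    replace (h * ((C * 2 ^ (2 * S N) + C + L) * h)) with
      (C * (2 ^ (2 * S N) * h ^ 2) + C * h ^ 2 + L * h ^ 2) by ring.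
    lra.
Qed.

Lemma Rabs_cos_le_1 y : Rabs (cos y) <= 1.
Proof. apply Rabs_le. pose proof (COS_bound y). lra. Qed.

Lemma Rabs_cos_plus_le y h : 0 <= h -> Rabs (cos (y + h)) <= Rabs (cos y) + h.
Proof.
  intro Hh. replace (cos (y + h)) with (cos y + (cos (y + h) - cos y)) by ring.
  eapply Rle_trans; [apply Rabs_triang|]. apply Rplus_le_compat_l.
  rewrite <- (Rabs_pos_eq h) at 2 by exact Hh. rewrite <- (Rmult_1_l (Rabs h)).
  replace (Rabs h) with (Rabs (y + h - y)) by (f_equal; ring).
  apply (is_derive_Rabs_le cos (fun x => - sin x)); [apply is_derive_cos|].
  intros x _. rewrite Rabs_Ropp. apply Rabs_le. pose proof (SIN_bound x). lra.
Qed.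

(** Interpolation halves the order, hence the exponent [2 * S N], and its steps have length at most
    [1], hence the radius [r + 1]. A step in [x] leaves [|cos y|] fixed; a step [h] in [y] increases
    it by at most [h], which is why the interpolation lemma allows [d + h]. *)
Lemma flat_Derive W : flat W ->
  flat (fun x y => Derive (fun x' => W x' y) x) /\ flat (fun x y => Derive (fun y' => W x y') y).
Proof.
  intros [HW HF]. destruct (Cinf2_Derive W HW) as [D1 [D2 [C1 C2]]].
  split; (split; [assumption|]); intros N r; destruct (HF (2 * S N)%nat (r + 1)) as [C [HC HB]].
  - destruct (Ck_lipschitz _ (C1 1%nat) (r + 1)) as [L [HL Lip]].
    exists (C * 2 ^ (2 * S N) + C + L). split.
    { assert (0 <= C * 2 ^ (2 * S N)) by (apply Rmult_le_pos; [|apply pow_le]; lra). lra. }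
    intros x y Hx Hy.
    pose proof (Rabs_cos_le_1 y) as Hc. pose proof (Rabs_pos (cos y)) as Hc0.
    assert (Hxh : forall z, Rabs (z - x) <= 1 -> Rabs z <= r + 1).
    { intros z Hz. replace z with (z - x + x) by ring.
      eapply Rle_trans; [apply Rabs_triang|lra]. }
    eapply Rle_trans.
    + apply (derive_le_interpolation (fun x => W x y) x _ (Rabs (cos y)) C L N); auto.
      * intros h Hh.
        apply (is_derive_lipschitz_remainder (fun x => W x y) (fun x => Derive (fun x' => W x' y) x));
          [intro z; apply D1| |exact HL].
        intros z Hz. rewrite (Rabs_pos_eq h) in Hz by lra.
        specialize (Lip 0 x y z y). rewrite Rminus_diag, Rabs_R0, Rplus_0_r in Lip.
        apply Lip; try lra. apply Hxh; lra.
      * intros h Hh. eapply Rle_trans; [apply HB; try lra; apply Hxh|].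
        -- replace (x + h - x) with h by ring. rewrite Rabs_pos_eq; lra.
        -- apply Rmult_le_compat_l; [exact HC|]. apply pow_incr; lra.
    + apply Rmult_le_compat_l.
      { assert (0 <= C * 2 ^ (2 * S N)) by (apply Rmult_le_pos; [|apply pow_le]; lra). lra. }
      simpl. pose proof (pow_le _ N Hc0). nra.
  - destruct (Ck_lipschitz _ (C2 1%nat) (r + 1)) as [L [HL Lip]].
    exists (C * 2 ^ (2 * S N) + C + L). split.
    { assert (0 <= C * 2 ^ (2 * S N)) by (apply Rmult_le_pos; [|apply pow_le]; lra). lra. }
    intros x y Hx Hy.
    pose proof (Rabs_cos_le_1 y) as Hc. pose proof (Rabs_pos (cos y)) as Hc0.
    assert (Hyh : forall z, Rabs (z - y) <= 1 -> Rabs z <= r + 1).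
    { intros z Hz. replace z with (z - y + y) by ring.
      eapply Rle_trans; [apply Rabs_triang|lra]. }
    eapply Rle_trans.
    + apply (derive_le_interpolation (fun y => W x y) y _ (Rabs (cos y)) C L N); auto.
      * intros h Hh.
        apply (is_derive_lipschitz_remainder (fun y => W x y) (fun y => Derive (fun y' => W x y') y));
          [intro z; apply D2| |exact HL].
        intros z Hz. rewrite (Rabs_pos_eq h) in Hz by lra.
        specialize (Lip 0 x y x z). rewrite Rminus_diag, Rabs_R0, Rplus_0_l in Lip.
        apply Lip; try lra. apply Hyh; lra.
      * intros h Hh. eapply Rle_trans; [apply HB; try lra; apply Hyh|].
        -- replace (y + h - y) with h by ring. rewrite Rabs_pos_eq; lra.
        -- apply Rmult_le_compat_l; [exact HC|]. apply pow_incr. split; [apply Rabs_pos|].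
           apply Rabs_cos_plus_le; lra.
    + apply Rmult_le_compat_l.
      { assert (0 <= C * 2 ^ (2 * S N)) by (apply Rmult_le_pos; [|apply pow_le]; lra). lra. }
      simpl. pose proof (pow_le _ N Hc0). nra.
Qed.

Lemma flat_eq_0 W x y : flat W -> cos y = 0 -> W x y = 0.
Proof.
  intros [_ HF] Hy. destruct (HF 1%nat (Rmax (Rabs x) (Rabs y))) as [C [_ HC]].
  specialize (HC x y (Rmax_l _ _) (Rmax_r _ _)).
  rewrite Hy, Rabs_R0, pow_1, Rmult_0_r in HC.
  apply Rabs_eq_0. pose proof (Rabs_pos (W x y)). lra.
Qed.

Definition cut (W : R -> R -> R) (x y : R) : R := if Rlt_dec (cos y) 0 then W x y else 0.

Lemma Rabs_cut_le W x y : Rabs (cut W x y) <= Rabs (W x y).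
Proof.
  unfold cut. destruct (Rlt_dec (cos y) 0); [lra|]. rewrite Rabs_R0. apply Rabs_pos.
Qed.

Lemma continuous_cos y : continuous cos y.
Proof.
  apply (ex_derive_continuous (K := R_AbsRing) (V := R_NormedModule)).
  eexists. apply is_derive_cos.
Qed.

(** Differentiation commutes with [cut]. This is local off the lines [cos y = 0]; on them, [W] and
    its [y]-derivative both vanish, and [|cut W| <= |W|] transfers the zero derivative. The
    derivatives of [W] are flat again, so the argument iterates. *)
Lemma flat_cut_Cinf2 W : flat W -> Cinf2 (cut W).
Proof.
  intros HW n. revert W HW. induction n as [|n IH]; intros W HW;
    (split; [intro r; destruct (Ck_bounded _ _ (proj1 HW 0%nat) r) as [M HM]; exists M;
       intros s x y Hx Hy; eapply Rle_trans; [apply Rabs_cut_le|exact (HM s x y Hx Hy)]|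
     split; [intros; apply continuous_const|]]).
  - exact I.
  - destruct (flat_Derive W HW) as [F1 F2]. destruct (Cinf2_Derive W (proj1 HW)) as [D1 [D2 _]].
    exists (fun _ => cut (fun x y => Derive (fun x' => W x' y) x)),
      (fun _ => cut (fun x y => Derive (fun y' => W x y') y)).
    apply and4_intro; [| |now apply IH|now apply IH]; intros _ x y.
    + unfold cut. destruct (Rlt_dec (cos y) 0); [apply D1|apply (is_derive_const 0)].
    + destruct (total_order_T (cos y) 0) as [[Hy|Hy]|Hy].
      * apply is_derive_ext_loc with (fun y => W x y).
        -- apply (filter_imp (fun z => cos z < 0)).
           ++ intros z Hz. unfold cut. destruct (Rlt_dec (cos z) 0); [reflexivity|lra].
           ++ exact (continuous_cos y (fun z => z < 0) (open_lt 0 _ Hy)).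
        -- unfold cut. destruct (Rlt_dec (cos y) 0); [apply D2|lra].
      * replace (cut (fun x y => Derive (fun y' => W x y') y) x y) with 0.
        -- apply is_derive_0_le with (fun y => W x y).
           ++ intro z. apply Rabs_cut_le.
           ++ now apply flat_eq_0.
           ++ rewrite <- (flat_eq_0 _ x y F2 Hy). apply D2.
        -- unfold cut. destruct (Rlt_dec (cos y) 0); lra.
      * apply is_derive_ext_loc with (fun _ => 0).
        -- apply (filter_imp (fun z => 0 < cos z)).
           ++ intros z Hz. unfold cut. destruct (Rlt_dec (cos z) 0); [lra|reflexivity].
           ++ exact (continuous_cos y (fun z => 0 < z) (open_gt 0 _ Hy)).
        -- unfold cut. destruct (Rlt_dec (cos y) 0); [lra|apply (is_derive_const 0)].
Qed.

(** * Even expansions at the boundary *)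

(** In the coordinate [v = artanh x] the radius is [e^(-v)], smooth for all [v] and free of square
    roots, and [x -> - x] is [v -> - v], the inversion in the unit circle. *)
Definition artanh (x : R) : R := ln ((1 + x) / (1 - x)) / 2.

(* [d/dx] in the variable [v = artanh x] *)
Definition dtanh (G : R -> R -> R) (v om : R) : R := cosh v ^ 2 * Derive (fun v' => G v' om) v.

Lemma Cinf2_dtanh G : Cinf2 G -> Cinf2 (dtanh G).
Proof.
  intros HG n. destruct (Cinf2_Derive G HG) as [_ [_ [C1 _]]].
  apply Ck_ext with (fun _ v om =>
    ((exp v + exp (-1 * v)) * / 2) * ((exp v + exp (-1 * v)) * / 2)
      * Derive (fun v' => G v' om) v).
  - intros s v om. unfold dtanh, cosh. replace (-1 * v) with (- v) by ring. field.
  - assert (CC : Ck n (fun _ v _ => (exp v + exp (-1 * v)) * / 2)).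
    { apply Ck_mult; [|apply Ck_const]. apply Ck_plus; apply Ck_exp; [apply Ck_fst|].
      apply Ck_mult; [apply Ck_const|apply Ck_fst]. }
    apply Ck_mult; [|apply C1]. apply Ck_mult; exact CC.
Qed.

Lemma Cinf2_iter_dtanh G n : Cinf2 G -> Cinf2 (Nat.iter n dtanh G).
Proof. intro HG. induction n as [|n IH]; [exact HG|]. simpl. now apply Cinf2_dtanh. Qed.

Lemma exp_artanh x : -1 < x < 1 -> exp (artanh x) ^ 2 = (1 + x) / (1 - x).
Proof.
  intro Hx. rewrite <- exp_INR_mult. unfold artanh.
  replace (INR 2 * (ln ((1 + x) / (1 - x)) / 2)) with (ln ((1 + x) / (1 - x)))
    by (simpl; field).
  apply exp_ln. apply Rdiv_lt_0_compat; lra.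
Qed.

Lemma exp_opp_artanh x : -1 < x < 1 -> exp (- artanh x) ^ 2 = (1 - x) / (1 + x).
Proof.
  intro Hx. rewrite exp_Ropp, pow_inv, exp_artanh by exact Hx. field. lra.
Qed.

Lemma rad_of_x_artanh x : -1 < x < 1 -> rad_of_x x = exp (- artanh x).
Proof.
  intro Hx. unfold rad_of_x. rewrite <- exp_opp_artanh by exact Hx.
  apply sqrt_pow2. left; apply exp_pos.
Qed.

Lemma cosh_artanh x : -1 < x < 1 -> cosh (artanh x) ^ 2 = / (1 - x ^ 2).
Proof.
  intro Hx. unfold cosh.
  assert (E : exp (artanh x) * exp (- artanh x) = 1) by (rewrite <- exp_plus, Rplus_opp_r; apply exp_0).
  replace (((exp (artanh x) + exp (- artanh x)) / 2) ^ 2) with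
    ((exp (artanh x) ^ 2 + exp (- artanh x) ^ 2 + 2 * (exp (artanh x) * exp (- artanh x))) / 4)
    by field.
  rewrite E, exp_artanh, exp_opp_artanh by exact Hx. field. repeat split; nra.
Qed.

Lemma is_derive_artanh x : -1 < x < 1 -> is_derive artanh x (cosh (artanh x) ^ 2).
Proof.
  intro Hx. rewrite cosh_artanh by exact Hx. unfold artanh. auto_derive.
  - split; [lra|split; [|exact I]]. apply Rdiv_lt_0_compat; lra.
  - field. repeat split; nra.
Qed.

Lemma Derive_n_artanh G f om n : Cinf2 G ->
  (forall x, -1 < x < 1 -> f x = G (artanh x) om) ->
  forall x, -1 < x < 1 -> Derive_n f n x = Nat.iter n dtanh G (artanh x) om.
Proof.
  intros HG Hf. induction n as [|n IH]; intros x Hx; [now apply Hf|].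
  change (Derive_n f (S n) x) with (Derive (Derive_n f n) x).
  apply is_derive_unique.
  apply is_derive_ext_loc with (fun x => Nat.iter n dtanh G (artanh x) om).
  - apply (filter_imp (fun z => -1 < z /\ z < 1)).
    + intros z Hz. symmetry. now apply IH.
    + apply filter_and; [apply (open_gt (-1)), Hx|apply (open_lt 1), Hx].
  - destruct (Cinf2_Derive _ (Cinf2_iter_dtanh G n HG)) as [D1 _].
    apply (is_derive_comp (fun v => Nat.iter n dtanh G v om) artanh x _ _
      (D1 _ _) (is_derive_artanh x Hx)).
Qed.

Lemma cosh_ge_1 v : 1 <= cosh v.
Proof.
  unfold cosh. pose proof (exp_pos v). pose proof (exp_pos (- v)).
  assert (E : exp v * exp (- v) = 1) by (rewrite <- exp_plus, Rplus_opp_r; apply exp_0).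
  assert (0 <= (exp v - exp (- v)) ^ 2) by apply pow2_ge_0. nra.
Qed.

(** Differentiation exchanges even and odd: the difference for [(G, eta)] has as derivative the
    difference for [(dtanh G, - eta)] divided by [cosh v ^ 2 >= 1]. The mean value theorem thus
    gains one power of [|v|] per step. Iterating [dtanh] instead of the [v]-derivative keeps the
    hypothesis a statement about derivatives in [x]. *)
Lemma parity_flat N : forall G eta, Cinf2 G -> Rabs eta = 1 ->
  (forall n om, (-1) ^ n = - eta -> Nat.iter n dtanh G 0 om = 0) ->
  forall r, exists C, 0 <= C /\ forall v om, Rabs v <= 1 -> Rabs om <= r ->
    Rabs (G v om - eta * G (- v) om) <= C * Rabs v ^ N.
Proof.
  induction N as [|N IH]; intros G eta HG Heta HP r.
  - destruct (Ck_bounded _ _ (HG 0%nat) (Rmax 1 r)) as [M HM].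
    exists (2 * Rmax 0 M). pose proof (Rmax_l 0 M). pose proof (Rmax_r 0 M).
    pose proof (Rmax_l 1 r). pose proof (Rmax_r 1 r).
    split; [lra|]. intros v om Hv Hom. simpl. rewrite Rmult_1_r.
    unfold Rminus. eapply Rle_trans; [apply Rabs_triang|].
    rewrite Rabs_Ropp, Rabs_mult, Heta.
    assert (B1 := HM 0 v om). assert (B2 := HM 0 (- v) om). rewrite Rabs_Ropp in B2.
    specialize (B1 ltac:(lra) ltac:(lra)). specialize (B2 ltac:(lra) ltac:(lra)). lra.
  - destruct (IH (dtanh G) (- eta)) with (r := r) as [C [HC HB]].
    + now apply Cinf2_dtanh.
    + now rewrite Rabs_Ropp.
    + intros n om Hn. rewrite Ropp_involutive in Hn. rewrite <- Nat.iter_succ_r.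
      apply HP. simpl. rewrite Hn. ring.
    + exists C. split; [exact HC|]. intros v om Hv Hom.
      destruct (Cinf2_Derive G HG) as [D1 _].
      (* For [eta = 1] the two terms cancel; for [eta = -1] the value [G 0 om] vanishes by the
         hypothesis at [n = 0]. *)
      assert (H0 : G 0 om - eta * G (- 0) om = 0).
      { rewrite Ropp_0. destruct (Rcase_abs eta) as [He|He].
        - rewrite Rabs_left in Heta by exact He.
          assert (G0 : G 0 om = 0) by (apply (HP 0%nat om); simpl; lra). rewrite G0. ring.
        - rewrite Rabs_right in Heta by exact He. rewrite Heta. ring. }
      set (d := fun v => G v om - eta * G (- v) om). change (d 0 = 0) in H0.
      replace (G v om - eta * G (- v) om) with (d v - d 0) by (rewrite H0; unfold d; ring).
      replace (C * Rabs v ^ S N) with (C * Rabs v ^ N * Rabs (v - 0))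
        by (rewrite Rminus_0_r; simpl; ring).
      apply (is_derive_Rabs_le d (fun v => (dtanh G v om - - eta * dtanh G (- v) om) / cosh v ^ 2)).
      * intro t. unfold d, dtanh.
        assert (Ec : cosh (- t) = cosh t) by (unfold cosh; rewrite Ropp_involutive; lra).
        rewrite Ec. pose proof (cosh_ge_1 t).
        replace (_ / cosh t ^ 2) with (Derive (fun v' => G v' om) t
           - eta * (-1 * Derive (fun v' => G v' om) (- t))) by (field; lra).
        apply (is_derive_minus (fun v => G v om) (fun v => eta * G (- v) om)); [apply D1|].
        apply (is_derive_scal (fun v => G (- v) om) t eta).
        apply (is_derive_comp (fun v => G v om) Ropp t); [apply D1|].
        auto_derive; [exact I|ring].
      * intros t Ht.
        assert (Htv : Rabs t <= Rabs v).
        { eapply Rabs_between; [exact Ht| |lra]. rewrite Rabs_R0. apply Rabs_pos. }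
        unfold Rdiv. rewrite Rabs_mult.
        pose proof (cosh_ge_1 t) as Hc.
        assert (Hi : Rabs (/ cosh t ^ 2) <= 1).
        { assert (1 <= cosh t ^ 2) by nra. rewrite Rabs_pos_eq.
          - rewrite <- Rinv_1. apply Rinv_le_contravar; lra.
          - left. apply Rinv_0_lt_compat. lra. }
        rewrite <- (Rmult_1_r (C * Rabs v ^ N)).
        apply Rmult_le_compat; [apply Rabs_pos|apply Rabs_pos| |exact Hi].
        eapply Rle_trans; [apply HB; [lra|exact Hom]|].
        apply Rmult_le_compat_l; [exact HC|]. apply pow_incr. split; [apply Rabs_pos|exact Htv].
Qed.

(** The bound [4 >= PI] keeps the angle in a fixed interval, so that a constant that is only locally
    uniform in the angle becomes uniform on the circle. *)
Lemma circle_angle a b : a ^ 2 + b ^ 2 = 1 ->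
  exists om, Rabs om <= 4 /\ a = cos om /\ b = sin om.
Proof.
  intro H. assert (Ha : -1 <= a <= 1) by nra.
  pose proof (acos_bound a) as Hac. pose proof PI_4 as HPI.
  assert (Hs : sin (acos a) = Rabs b).
  { rewrite sin_acos by exact Ha. rewrite <- sqrt_Rsqr_abs. f_equal. unfold Rsqr. nra. }
  destruct (Rcase_abs b) as [Hb|Hb].
  - exists (- acos a). split; [|split].
    + rewrite Rabs_Ropp, Rabs_pos_eq; lra.
    + rewrite cos_neg, cos_acos; auto.
    + rewrite sin_neg, Hs, Rabs_left; lra.
  - exists (acos a). split; [|split].
    + rewrite Rabs_pos_eq; lra.
    + rewrite cos_acos; auto.
    + rewrite Hs, Rabs_right; lra.
Qed.

Lemma artanh_le x : - / 2 <= x <= / 2 -> Rabs (artanh x) <= 2 * Rabs x.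
Proof.
  assert (Pos : forall y, 0 <= y <= / 2 -> 0 <= artanh y <= 2 * y).
  { intros y Hy. unfold artanh.
    assert (E1 : 1 <= (1 + y) / (1 - y)).
    { apply Rmult_le_reg_r with (1 - y); [lra|]. unfold Rdiv.
      rewrite Rmult_assoc, Rinv_l by lra. lra. }
    assert (L0 : 0 <= ln ((1 + y) / (1 - y))).
    { rewrite <- ln_1. destruct E1 as [E1|E1]; [left; apply ln_increasing; lra|rewrite <- E1; lra]. }
    split; [lra|].
    assert (ln ((1 + y) / (1 - y)) <= 4 * y); [|lra].
    assert (E2 : (1 + y) / (1 - y) <= 1 + 4 * y).
    { apply Rmult_le_reg_r with (1 - y); [lra|]. unfold Rdiv.
      rewrite Rmult_assoc, Rinv_l by lra. nra. }
    apply Rnot_lt_le. intro Hl. apply exp_increasing in Hl. rewrite exp_ln in Hl by lra.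
    pose proof (exp_ineq1_le (4 * y)). lra. }
  intro Hx. destruct (Rle_dec 0 x) as [H|H].
  - specialize (Pos x ltac:(lra)). rewrite !Rabs_pos_eq; lra.
  - specialize (Pos (- x) ltac:(lra)).
    assert (E : artanh (- x) = - artanh x).
    { unfold artanh. replace ((1 + - x) / (1 - - x)) with (/ ((1 + x) / (1 - x))) by (field; lra).
      rewrite ln_Rinv by (apply Rdiv_lt_0_compat; lra). field. }
    rewrite E in Pos. rewrite !Rabs_left1; lra.
Qed.

Definition even_at_boundary (g : R -> R -> R) : Prop := forall k om,
  Derive_n (fun x => g (rad_of_x x * cos om) (rad_of_x x * sin om)) (2 * k + 1) 0 = 0.

(** The two points lie on one ray, at radii [e^(-v)] and [e^v] with [v = artanh x]; their difference
    is thus the even case of [parity_flat], and [|v| <= 2 * |x|] accounts for the factor [2 ^ N]. *)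
Lemma even_expansion_flat (g : R -> R -> R) : Cinf2 g -> even_at_boundary g ->
  forall N, exists C, 0 <= C /\ forall a b x, - / 2 <= x <= / 2 -> a ^ 2 + b ^ 2 = 1 - x ^ 2 ->
    Rabs (g (a / (1 + x)) (b / (1 + x)) - g (a / (1 - x)) (b / (1 - x))) <= C * Rabs x ^ N.
Proof.
  intros Hg Hodd N.
  set (G := fun v om => g (exp (-1 * v) * cos om) (exp (-1 * v) * sin om)).
  assert (HG : Cinf2 G).
  { intro n. assert (CE : Ck n (fun _ v _ => exp (-1 * v))).
    { apply Ck_exp, Ck_mult; [apply Ck_const|apply Ck_fst]. }
    apply (Ck_comp n g (fun _ v om => exp (-1 * v) * cos om) (fun _ v om => exp (-1 * v) * sin om));
      [apply Hg| |]; (apply Ck_mult; [exact CE|]); [apply Ck_cos|apply Ck_sin]; apply Ck_snd. }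
  assert (A0 : artanh 0 = 0).
  { unfold artanh. replace ((1 + 0) / (1 - 0)) with 1 by field. rewrite ln_1. field. }
  destruct (parity_flat N G 1 HG Rabs_R1) with (r := 4) as [C [HC HB]].
  { intros n om Hn. destruct (Nat.Even_or_Odd n) as [[k ->]|[k ->]].
    - rewrite pow_1_even in Hn. lra.
    - rewrite <- A0 at 1. etransitivity; [symmetry|exact (Hodd k om)].
      apply (Derive_n_artanh G); [exact HG| |lra].
      intros x Hx. unfold G. rewrite (rad_of_x_artanh x Hx).
      now replace (-1 * artanh x) with (- artanh x) by ring. }
  exists (C * 2 ^ N). split; [apply Rmult_le_pos; [exact HC|apply pow_le; lra]|].
  intros a b x Hx Hab.
  pose proof (exp_opp_artanh x ltac:(lra)) as HE.
  pose proof (exp_pos (- artanh x)) as HEp. set (E := exp (- artanh x)) in *.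
  assert (HEx : E ^ 2 * (1 + x) = 1 - x) by (rewrite HE; field; lra).
  (* [q] is the norm of [(a, b)], that is [sqrt (1 - x ^ 2)], in a form from which the radii
     [E = q / (1 + x)] and [/ E = q / (1 - x)] are read off. *)
  set (q := (1 + x) * E).
  assert (Hq : 0 < q) by (apply Rmult_lt_0_compat; lra).
  assert (Hq2 : q ^ 2 = 1 - x ^ 2).
  { unfold q. replace (((1 + x) * E) ^ 2) with ((1 + x) * (E ^ 2 * (1 + x))) by ring.
    rewrite HEx. ring. }
  destruct (circle_angle (a / q) (b / q)) as [om [Hom [Ha Hb]]].
  { replace ((a / q) ^ 2 + (b / q) ^ 2) with ((a ^ 2 + b ^ 2) / q ^ 2) by (field; lra).
    rewrite Hab, Hq2. field. nra. }
  assert (Hv : Rabs (artanh x) <= 1).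
  { eapply Rle_trans; [now apply artanh_le|]. apply Rle_trans with (2 * / 2); [|lra].
    apply Rmult_le_compat_l; [lra|]. apply Rabs_le. lra. }
  specialize (HB (artanh x) om Hv Hom).
  assert (Ei : exp (artanh x) = / E) by (unfold E; rewrite exp_Ropp, Rinv_inv; reflexivity).
  assert (Exm : / E = q / (1 - x)).
  { apply Rmult_eq_reg_l with E; [|lra]. rewrite Rinv_r by lra.
    unfold q. replace (E * ((1 + x) * E / (1 - x))) with (E ^ 2 * (1 + x) / (1 - x)) by (field; lra).
    rewrite HEx. field. lra. }
  unfold G in HB.
  replace (-1 * artanh x) with (- artanh x) in HB by ring.
  replace (-1 * - artanh x) with (artanh x) in HB by ring.
  rewrite Ei, Exm, <- Ha, <- Hb in HB. fold E in HB.
  replace (a / (1 + x)) with (E * (a / q)) by (unfold q; field; lra).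
  replace (b / (1 + x)) with (E * (b / q)) by (unfold q; field; lra).
  replace (a / (1 - x)) with (q / (1 - x) * (a / q)) by (field; lra).
  replace (b / (1 - x)) with (q / (1 - x) * (b / q)) by (field; lra).
  rewrite Rmult_1_l in HB. eapply Rle_trans; [exact HB|].
  rewrite Rmult_assoc, <- Rpow_mult_distr. apply Rmult_le_compat_l; [exact HC|].
  apply pow_incr. split; [apply Rabs_pos|now apply artanh_le].
Qed.

(** * The transform in fan-beam coordinates *)

(* In the Klein model the geodesic is the chord [s |-> (klein1, klein2)] and the boundary
   defining function is [x_geod]. *)
Definition x_geod (s al : R) : R := cos al * / cosh s.
Definition klein1 (s beta al : R) : R :=
  - (cos (beta + al) * cos al * (sinh s / cosh s) - sin (beta + al) * sin al).
Definition klein2 (s beta al : R) : R :=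
  - (sin (beta + al) * cos al * (sinh s / cosh s) + cos (beta + al) * sin al).

Lemma cosh_opp s : cosh (- s) = cosh s.
Proof. unfold cosh. rewrite Ropp_involutive. lra. Qed.

Lemma sinh_opp s : sinh (- s) = - sinh s.
Proof. unfold sinh. rewrite Ropp_involutive. lra. Qed.

Lemma cosh_sinh s : cosh s ^ 2 = 1 + sinh s ^ 2.
Proof.
  unfold cosh, sinh.
  assert (E : exp s * exp (- s) = 1) by (rewrite <- exp_plus, Rplus_opp_r; apply exp_0).
  nra.
Qed.

Lemma klein_norm s beta al : klein1 s beta al ^ 2 + klein2 s beta al ^ 2 = 1 - x_geod s al ^ 2.
Proof.
  unfold klein1, klein2, x_geod. pose proof (cosh_ge_1 s). pose proof (cosh_sinh s) as Hcs.
  pose proof (sin2_cos2 (beta + al)) as H1. pose proof (sin2_cos2 al) as H2. unfold Rsqr in *.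
  set (C := cos (beta + al)) in *. set (S := sin (beta + al)) in *.
  set (c := cos al) in *. set (d := sin al) in *.
  assert (HT : (sinh s / cosh s) ^ 2 = 1 - (/ cosh s) ^ 2).
  { replace (sinh s ^ 2) with (cosh s ^ 2 - 1) by lra.
    replace ((sinh s / cosh s) ^ 2) with (sinh s ^ 2 / cosh s ^ 2) by (field; lra).
    replace (sinh s ^ 2) with (cosh s ^ 2 - 1) by lra. field. lra. }
  set (T := sinh s / cosh s) in *. set (K := / cosh s) in *.
  replace ((- (C * c * T - S * d)) ^ 2 + (- (S * c * T + C * d)) ^ 2)
    with ((S * S + C * C) * (c ^ 2 * T ^ 2 + d * d)) by ring.
  rewrite H1, HT. replace (d * d) with (1 - c * c) by lra. ring.
Qed.

Lemma x_geod_bound s al : Rabs (x_geod s al) <= Rabs (cos al).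
Proof.
  unfold x_geod. pose proof (cosh_ge_1 s). rewrite Rabs_mult, <- (Rmult_1_r (Rabs (cos al))) at 1.
  replace (Rabs (cos al) * 1 * Rabs (/ cosh s)) with (Rabs (cos al) * Rabs (/ cosh s)) by ring.
  rewrite <- (Rmult_1_r (Rabs (cos al))) at 2.
  apply Rmult_le_compat_l; [apply Rabs_pos|].
  rewrite Rabs_pos_eq by (left; apply Rinv_0_lt_compat; lra).
  rewrite <- Rinv_1. apply Rinv_le_contravar; lra.
Qed.

(** With [inv_ext] in place of [1 / (1 + x)] the kernel is smooth for all real [al]. It is the
    genuine value of [g] at [P / (1 + x)] as long as [cos al >= - 1/2], which covers both the inward
    directions and a neighbourhood of the gluing lines. *)
Definition kernel (g : R -> R -> R) (s beta al : R) : R :=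
  g (klein1 s beta al * inv_ext (x_geod s al)) (klein2 s beta al * inv_ext (x_geod s al)).

Lemma continuous_of_derive (f : R -> R) s : ex_derive f s -> continuous f s.
Proof. apply (ex_derive_continuous (K := R_AbsRing) (V := R_NormedModule)). Qed.

Lemma ex_derive_inv_cosh s : ex_derive (fun s => / cosh s) s.
Proof.
  pose proof (cosh_ge_1 s) as H. unfold cosh in *. auto_derive. lra.
Qed.

Lemma inv_cosh_bound s : 0 < / cosh s <= 1.
Proof.
  pose proof (cosh_ge_1 s). split; [apply Rinv_0_lt_compat; lra|].
  rewrite <- Rinv_1. apply Rinv_le_contravar; lra.
Qed.

Lemma Cinf_kernel g : Cinf2 g -> Cinf (kernel g).
Proof.
  intros Hg n.
  assert (CK : Ck n (fun s _ _ => / cosh s)).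
  { apply (Ck_param n (fun s => / cosh s)).
    - exists 1. intro s. pose proof (inv_cosh_bound s). rewrite Rabs_pos_eq; lra.
    - intro s. apply continuous_of_derive, ex_derive_inv_cosh. }
  assert (CT : Ck n (fun s _ _ => sinh s / cosh s)).
  { apply (Ck_param n (fun s => sinh s / cosh s)).
    - exists 1. intro s. pose proof (cosh_ge_1 s) as Hc. pose proof (cosh_sinh s) as Hcs.
      unfold Rdiv. rewrite Rabs_mult, (Rabs_pos_eq (/ cosh s)) by (left; apply Rinv_0_lt_compat; lra).
      apply Rmult_le_reg_r with (cosh s); [lra|]. rewrite Rmult_assoc, Rinv_l by lra.
      rewrite Rmult_1_r, Rmult_1_l. apply Rabs_le. nra.
    - intro s. apply continuous_of_derive.
      pose proof (cosh_ge_1 s) as H. unfold cosh, sinh in *. auto_derive. lra. }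
  assert (Cs : Ck n (fun _ beta al => sin (beta + al))).
  { apply Ck_sin, Ck_plus; [apply Ck_fst|apply Ck_snd]. }
  assert (Cc : Ck n (fun _ beta al => cos (beta + al))).
  { apply Ck_cos, Ck_plus; [apply Ck_fst|apply Ck_snd]. }
  assert (Csa : Ck n (fun _ _ al => sin al)) by (apply Ck_sin, Ck_snd).
  assert (Cca : Ck n (fun _ _ al => cos al)) by (apply Ck_cos, Ck_snd).
  assert (CX : Ck n (fun s _ al => inv_ext (x_geod s al))).
  { apply (Ck_inv_ext n (fun s _ al => x_geod s al)).
    - intros s _ al. pose proof (x_geod_bound s al) as Hx. pose proof (Rabs_cos_le_1 al).
      assert (Hx' : Rabs (x_geod s al) <= 1) by lra. apply Rabs_le_between in Hx'. lra.
    - exact (Ck_mult n _ _ Cca CK). }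
  apply (Ck_comp n g (fun s beta al => klein1 s beta al * inv_ext (x_geod s al))
    (fun s beta al => klein2 s beta al * inv_ext (x_geod s al))); [apply Hg| |].
  - refine (Ck_mult n (fun s beta al => klein1 s beta al) _ _ CX).
    apply (Ck_opp n (fun s beta al =>
      cos (beta + al) * cos al * (sinh s / cosh s) - sin (beta + al) * sin al)).
    exact (Ck_minus n _ _ (Ck_mult n _ _ (Ck_mult n _ _ Cc Cca) CT) (Ck_mult n _ _ Cs Csa)).
  - refine (Ck_mult n (fun s beta al => klein2 s beta al) _ _ CX).
    apply (Ck_opp n (fun s beta al =>
      sin (beta + al) * cos al * (sinh s / cosh s) + cos (beta + al) * sin al)).
    exact (Ck_plus n _ _ (Ck_mult n _ _ (Ck_mult n _ _ Cs Cca) CT) (Ck_mult n _ _ Cc Csa)).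
Qed.

(** * The weighted integral and its symmetries *)

Definition weight (p s : R) : R := Rpower (/ cosh s) p.

Lemma weight_decay p : 0 < p -> exp_decay p (Rpower 2 p) (weight p).
Proof.
  intro Hp. split.
  - intro s. apply continuous_of_derive. unfold weight, Rpower.
    pose proof (inv_cosh_bound s) as H. pose proof (cosh_ge_1 s).
    unfold cosh in *. auto_derive. split; lra.
  - intro s. unfold weight. rewrite Rabs_pos_eq by (left; apply exp_pos).
    assert (E : exp (- p * Rabs s) = Rpower (exp (- Rabs s)) p).
    { unfold Rpower. rewrite ln_exp. f_equal. ring. }
    rewrite E, Rpower_mult_distr by (try lra; apply exp_pos).
    apply Rle_Rpower_l; [lra|]. split; [apply inv_cosh_bound|].
    assert (Hc : exp (Rabs s) / 2 <= cosh s).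
    { unfold cosh. pose proof (exp_pos s). pose proof (exp_pos (- s)).
      unfold Rabs. destruct (Rcase_abs s); lra. }
    rewrite exp_Ropp. replace (2 * / exp (Rabs s)) with (/ (exp (Rabs s) / 2)).
    + apply Rinv_le_contravar; [|exact Hc]. pose proof (exp_pos (Rabs s)). lra.
    + field. apply Rgt_not_eq, exp_pos.
Qed.

(** For [|al| <= PI / 2] this is the function [u], one real component at a time; for the other
    directions it is only a smooth continuation, which [fan_ext] corrects. *)
Definition fan_int (p : R) (g : R -> R -> R) (beta al : R) : R :=
  line_int (fun s => weight p s * kernel g s beta al).

Lemma fan_int_Cinf2 p g : 0 < p -> Cinf2 g -> Cinf2 (fan_int p g).
Proof.
  intros Hp Hg n.
  apply (Ck_line_int p _ (weight p) Hp (weight_decay p Hp) n (kernel g)), Cinf_kernel, Hg.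
Qed.

Lemma cos_plus_2PI x : cos (x + 2 * PI) = cos x.
Proof. rewrite cos_plus, cos_2PI, sin_2PI. ring. Qed.

Lemma sin_plus_2PI x : sin (x + 2 * PI) = sin x.
Proof. rewrite sin_plus, cos_2PI, sin_2PI. ring. Qed.

Lemma fan_int_fst_periodic p g beta al : fan_int p g (beta + 2 * PI) al = fan_int p g beta al.
Proof.
  unfold fan_int. f_equal. apply functional_extensionality; intro s. f_equal.
  unfold kernel, klein1, klein2.
  replace (beta + 2 * PI + al) with (beta + al + 2 * PI) by ring.
  now rewrite cos_plus_2PI, sin_plus_2PI.
Qed.

Lemma fan_int_snd_periodic p g beta al : fan_int p g beta (al + 2 * PI) = fan_int p g beta al.
Proof.
  unfold fan_int. f_equal. apply functional_extensionality; intro s. f_equal.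
  unfold kernel, klein1, klein2, x_geod. rewrite <- Rplus_assoc.
  now rewrite !cos_plus_2PI, !sin_plus_2PI.
Qed.

Lemma fan_int_antipodal p g beta al :
  fan_int p g (beta + PI + 2 * al) (- al) = fan_int p g beta al.
Proof.
  unfold fan_int. rewrite <- line_int_opp. f_equal. apply functional_extensionality; intro s.
  unfold weight. rewrite cosh_opp. f_equal.
  unfold kernel, klein1, klein2, x_geod. rewrite cosh_opp, sinh_opp, cos_neg, sin_neg.
  replace (beta + PI + 2 * al + - al) with (beta + al + PI) by ring.
  rewrite neg_cos, neg_sin. pose proof (cosh_ge_1 s).
  f_equal; f_equal; field; lra.
Qed.

(** The reversal [s -> - s] compensates the sign change of [cos al] in [P], so that only the sign of
    [x] remains changed; [line_int] does not see the reversal. *)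
Lemma kernel_scattering g s beta al : kernel g (- s) (beta + PI + 2 * al) (PI - al) =
  g (klein1 s beta al * inv_ext (- x_geod s al)) (klein2 s beta al * inv_ext (- x_geod s al)).
Proof.
  unfold kernel, klein1, klein2, x_geod. rewrite cosh_opp, sinh_opp.
  replace (beta + PI + 2 * al + (PI - al)) with (beta + al + 2 * PI) by ring.
  rewrite cos_plus_2PI, sin_plus_2PI.
  replace (PI - al) with (- al + PI) by ring. rewrite neg_cos, neg_sin, cos_neg, sin_neg.
  pose proof (cosh_ge_1 s).
  replace (- cos al * / cosh s) with (- (cos al * / cosh s)) by ring.
  f_equal; f_equal; field; lra.
Qed.

Lemma fan_int_scattering p g beta al : fan_int p g (beta + PI + 2 * al) (PI - al) =
  line_int (fun s => weight p s * g (klein1 s beta al * inv_ext (- x_geod s al))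
    (klein2 s beta al * inv_ext (- x_geod s al))).
Proof.
  unfold fan_int. rewrite <- line_int_opp. f_equal. apply functional_extensionality; intro s.
  rewrite kernel_scattering. unfold weight. now rewrite cosh_opp.
Qed.

(** * Gluing across the glancing directions *)

Definition jump (p : R) (g : R -> R -> R) (beta al : R) : R :=
  fan_int p g beta al - fan_int p g (beta + PI + 2 * al) (PI - al).

Lemma jump_Cinf2 p g : 0 < p -> Cinf2 g -> Cinf2 (jump p g).
Proof.
  intros Hp Hg n.
  apply (Ck_minus n (fun _ => fan_int p g) (fun _ beta al =>
    fan_int p g (beta + PI + 2 * al) (PI - al))); [now apply fan_int_Cinf2|].
  apply (Ck_comp n (fan_int p g) (fun _ beta al => beta + PI + 2 * al) (fun _ _ al => PI - al)).
  - now apply fan_int_Cinf2.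
  - apply (Ck_plus n (fun _ beta _ => beta + PI) (fun _ _ al => 2 * al)).
    + apply Ck_plus; [apply Ck_fst|apply Ck_const].
    + apply Ck_mult; [apply Ck_const|apply Ck_snd].
  - apply (Ck_minus n (fun _ _ _ => PI) (fun _ _ al => al)); [apply Ck_const|apply Ck_snd].
Qed.

(** For [|cos al| <= 1/2] one has [|x| <= 1/2] for all [s], so [inv_ext] is exact at both [x] and
    [- x] and the even expansion applies under the integral. For larger [|cos al|] mere boundedness
    suffices, since [(2 * |cos al|) ^ N >= 1]. *)
Lemma jump_flat p g : 0 < p -> Cinf2 g -> even_at_boundary g -> flat (jump p g).
Proof.
  intros Hp Hg Hev. split; [now apply jump_Cinf2|]. intros N r.
  destruct (even_expansion_flat g Hg Hev N) as [C [HC HB]].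
  destruct (Ck_bounded _ _ (jump_Cinf2 p g Hp Hg 0%nat) r) as [M HM].
  set (c := Rpower 2 p). set (C1 := 2 * (c * C) / p). set (C2 := Rmax 0 M * 2 ^ N).
  assert (Hc : 0 < c) by apply exp_pos.
  assert (HC1 : 0 <= C1).
  { unfold C1. apply Rmult_le_pos; [|left; now apply Rinv_0_lt_compat].
    apply Rmult_le_pos; [lra|]. apply Rmult_le_pos; lra. }
  assert (HC2 : 0 <= C2).
  { apply Rmult_le_pos; [apply Rmax_l|apply pow_le; lra]. }
  exists (C1 + C2). split; [lra|]. intros beta al Hbeta Hal.
  pose proof (Rabs_pos (cos al)) as Hcos.
  assert (HcN : 0 <= Rabs (cos al) ^ N) by now apply pow_le.
  destruct (Rle_dec (Rabs (cos al)) (/ 2)) as [Hsmall|Hbig].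
  - apply Rle_trans with (C1 * Rabs (cos al) ^ N); [|apply Rmult_le_compat_r; lra].
    set (k' := fun s => g (klein1 s beta al * inv_ext (- x_geod s al))
                          (klein2 s beta al * inv_ext (- x_geod s al))).
    set (k := fun s => kernel g s beta al).
    assert (Ek : k' = fun s => kernel g (- s) (beta + PI + 2 * al) (PI - al)).
    { apply functional_extensionality; intro s. symmetry. apply kernel_scattering. }
    destruct (Ck_bounded _ _ (Cinf_kernel g Hg 0%nat) (Rabs beta + Rabs al)) as [M1 HM1].
    destruct (Ck_bounded _ _ (Cinf_kernel g Hg 0%nat)
      (Rabs (beta + PI + 2 * al) + Rabs (PI - al))) as [M2 HM2].
    pose proof (Ck_continuous _ _ (Cinf_kernel g Hg 0%nat)) as Hcont.
    pose proof (weighted_remainder p c (weight p) Hp (weight_decay p Hp) k' k (fun _ => 0)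
      M2 M1 0 (C * Rabs (cos al) ^ N) 0) as HW.
    unfold jump. rewrite fan_int_scattering. fold k'. unfold fan_int. fold k.
    rewrite Rmult_0_l, Rminus_0_r in HW.
    replace (C1 * Rabs (cos al) ^ N) with (2 * (c * (C * Rabs (cos al) ^ N)) / p)
      by (unfold C1; field; lra).
    apply HW.
    + intro s. rewrite Ek.
      apply (continuous_comp Ropp (fun s => kernel g s (beta + PI + 2 * al) (PI - al)));
        [|apply Hcont].
      apply (continuous_opp (fun s : R => s)), continuous_id.
    + intro s. apply Hcont.
    + intro s. apply continuous_const.
    + intro s. rewrite Ek. pose proof (Rabs_pos (beta + PI + 2 * al)).
      pose proof (Rabs_pos (PI - al)). apply HM2; lra.
    + intro s. pose proof (Rabs_pos beta). pose proof (Rabs_pos al). apply HM1; lra.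
    + intro s. rewrite Rabs_R0. lra.
    + intro s. rewrite Rmult_0_l, Rminus_0_r. unfold k, k', kernel.
      pose proof (x_geod_bound s al) as Hx.
      assert (Hx2 : - / 2 <= x_geod s al <= / 2).
      { assert (Hx' : Rabs (x_geod s al) <= / 2) by lra.
        now apply Rabs_le_between in Hx'. }
      rewrite !inv_ext_eq by lra.
      eapply Rle_trans; [apply (HB _ _ (x_geod s al) Hx2), klein_norm|].
      apply Rmult_le_compat_l; [exact HC|]. apply pow_incr. split; [apply Rabs_pos|exact Hx].
  - apply Rle_trans with (C2 * Rabs (cos al) ^ N); [|apply Rmult_le_compat_r; lra].
    unfold C2. rewrite Rmult_assoc, <- Rpow_mult_distr.
    assert (1 <= (2 * Rabs (cos al)) ^ N) by (apply pow_R1_Rle; lra).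
    pose proof (HM 0 beta al Hbeta Hal). pose proof (Rmax_l 0 M). pose proof (Rmax_r 0 M). nra.
Qed.

(** This is [A_+ u]: where [cos al < 0], subtracting the jump leaves the integral at the scattered
    direction. In this form it is a smooth function minus a cut flat one. *)
Definition fan_ext (p : R) (g : R -> R -> R) (beta al : R) : R :=
  fan_int p g beta al - cut (jump p g) beta al.

Lemma fan_ext_smooth2 p g : 0 < p -> Cinf2 g -> even_at_boundary g -> smooth2 (fan_ext p g).
Proof.
  intros Hp Hg Hev. apply Cinf2_smooth2. intro n.
  apply (Ck_minus n (fun _ => fan_int p g) (fun _ => cut (jump p g))).
  - now apply fan_int_Cinf2.
  - now apply flat_cut_Cinf2, jump_flat.
Qed.

Lemma fan_ext_fst_periodic p g beta al : fan_ext p g (beta + 2 * PI) al = fan_ext p g beta al.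
Proof.
  unfold fan_ext, cut, jump. rewrite fan_int_fst_periodic.
  replace (beta + 2 * PI + PI + 2 * al) with (beta + PI + 2 * al + 2 * PI) by ring.
  now rewrite fan_int_fst_periodic.
Qed.

Lemma fan_ext_snd_periodic p g beta al : fan_ext p g beta (al + 2 * PI) = fan_ext p g beta al.
Proof.
  unfold fan_ext, cut, jump. rewrite fan_int_snd_periodic, cos_plus_2PI.
  replace (beta + PI + 2 * (al + 2 * PI)) with (beta + PI + 2 * al + 2 * PI + 2 * PI) by ring.
  rewrite !fan_int_fst_periodic.
  rewrite <- (fan_int_snd_periodic p g (beta + PI + 2 * al) (PI - (al + 2 * PI))).
  now replace (PI - (al + 2 * PI) + 2 * PI) with (PI - al) by ring.
Qed.

Lemma fan_ext_in p g beta al : - PI / 2 <= al <= PI / 2 ->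
  fan_ext p g beta al = fan_int p g beta al.
Proof.
  intro Hal. unfold fan_ext, cut. destruct (Rlt_dec (cos al) 0) as [H|H]; [|ring].
  assert (0 <= cos al) by (apply cos_ge_0; lra). lra.
Qed.

Lemma fan_ext_out p g beta al : 0 < p -> Cinf2 g -> even_at_boundary g ->
  PI / 2 <= al <= 3 * PI / 2 -> fan_ext p g beta al = fan_int p g (beta + PI + 2 * al) (PI - al).
Proof.
  intros Hp Hg Hev Hal. unfold fan_ext, cut. destruct (Rlt_dec (cos al) 0) as [H|H].
  - unfold jump. ring.
  (* At the two endpoints the cut is inactive; the two prescriptions agree there because the jump
     vanishes. *)
  - assert (H0 : cos al = 0).
    { assert (cos al <= 0) by (apply cos_le_0; lra). lra. }
    pose proof (flat_eq_0 _ beta al (jump_flat p g Hp Hg Hev) H0) as E.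
    unfold jump in E. lra.
Qed.

Lemma Cinf_alpha_plus_fan_int p (g1 g2 : R -> R -> R) : 0 < p ->
  Cinf2 g1 -> Cinf2 g2 -> even_at_boundary g1 -> even_at_boundary g2 ->
  Cinf_alpha_plus (fun beta al => (fan_int p g1 beta al, fan_int p g2 beta al)).
Proof.
  intros Hp Hg1 Hg2 He1 He2. split; [|split].
  - intros. now rewrite !fan_int_fst_periodic.
  - exists (fun beta al => (fan_ext p g1 beta al, fan_ext p g2 beta al)).
    split; [|split; [|split; [|split]]].
    + split; now apply fan_ext_smooth2.
    + intros. now rewrite !fan_ext_fst_periodic.
    + intros. now rewrite !fan_ext_snd_periodic.
    + intros. now rewrite !fan_ext_in.
    + intros. now rewrite !fan_ext_out.
  - intros. now rewrite !fan_int_antipodal.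
Qed.

(** * The geodesics in the shifted parameter *)

(** With [E = e^s] and [c = cos al], the shift gives [tanh (t / 2) = (c E - 1) / (c E + 1)].
    Everything becomes rational in [E], [c] and [d = sin al], and the identity reduces to
    [c^2 + d^2 = 1]. *)
Lemma gammaH_eq beta a s :
  gammaH beta a (s + ln (cos (atan a))) =
  (klein1 s beta (atan a) / (1 + x_geod s (atan a)),
   klein2 s beta (atan a) / (1 + x_geod s (atan a))).
Proof.
  set (al := atan a).
  assert (Hc : 0 < cos al) by (pose proof (atan_bound a); apply cos_gt_0; unfold al; lra).
  assert (Ha : a = sin al / cos al) by (unfold al; rewrite <- (tan_atan a) at 1; reflexivity).
  pose proof (sin2_cos2 al) as Hcd. unfold Rsqr in Hcd.
  unfold klein1, klein2, x_geod. rewrite Ha. clear Ha. clearbody al. clear a.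
  unfold gammaH, cis. rewrite cos_plus, sin_plus.
  set (c := cos al) in *. set (d := sin al) in *. set (th := Defs.tanh _).
  set (E := exp s). assert (HE : 0 < E) by apply exp_pos.
  assert (Hth : th = (c * E - 1) / (c * E + 1)).
  { unfold th, Defs.tanh.
    assert (E2 : exp ((s + ln c) / 2) ^ 2 = c * E).
    { rewrite <- exp_INR_mult. replace (INR 2 * ((s + ln c) / 2)) with (s + ln c) by (simpl; field).
      rewrite exp_plus, exp_ln by exact Hc. unfold E. ring. }
    rewrite exp_Ropp, <- E2. pose proof (exp_pos ((s + ln c) / 2)).
    field. split; nra. }
  assert (HK : / cosh s = 2 * E / (E ^ 2 + 1)).
  { unfold cosh. rewrite exp_Ropp. fold E. field. split; nra. }
  assert (HT : sinh s / cosh s = (E ^ 2 - 1) / (E ^ 2 + 1)).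
  { unfold Rdiv at 1. rewrite HK. unfold sinh. rewrite exp_Ropp. fold E. field. split; nra. }
  assert (HcE : 0 < c * E) by now apply Rmult_lt_0_compat.
  set (D := E ^ 2 + 1 + 2 * c * E). assert (HD : 0 < D) by (unfold D; nra).
  assert (Hx : 1 + c * / cosh s = D / (E ^ 2 + 1)) by (rewrite HK; unfold D; field; nra).
  (* [z0] is [e^(- i beta) P / (1 + x)] written out from [- (c + i d) (c tanh s + i d)]. The
     quotient is verified by multiplying with the denominator, whose real part is [-2]. *)
  set (z0 := (- (c * c * (E ^ 2 - 1) - d * d * (E ^ 2 + 1)) / D, - (2 * c * d * E ^ 2) / D) : C).
  assert (Hquot : ((((RtoC 2 + Ci * RtoC (d / c)) * RtoC th + Ci * RtoC (d / c))
     / (Ci * RtoC (d / c) * RtoC th - RtoC 2 + Ci * RtoC (d / c)))%C = z0)).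
  { set (num := (_ + Ci * RtoC (d / c))%C). set (den := (_ - RtoC 2 + _)%C).
    assert (Hnum : num = (2 * (c * E - 1) / (c * E + 1), 2 * d * E / (c * E + 1))).
    { unfold num, Ci, RtoC, Cmult, Cplus; simpl. rewrite Hth. f_equal; field; lra. }
    assert (Hden : den = (-2, 2 * d * E / (c * E + 1))).
    { unfold den, Ci, RtoC, Cmult, Cplus, Cminus, Copp; simpl. rewrite Hth. f_equal; field; lra. }
    assert (Hden0 : den <> 0).
    { rewrite Hden. intro H. apply (f_equal fst) in H. simpl in H. lra. }
    assert (Heq : num = (z0 * den)%C).
    { rewrite Hnum, Hden. unfold z0, Cmult; simpl.
      replace (d * d) with (1 - c * c) by lra.
      replace (- (2 * c * d * (E * (E * 1))) / D * (2 * d * E / (c * E + 1)))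
        with (- (4 * c * (d * d) * E ^ 3) / D / (c * E + 1)) by (field; lra).
      replace (d * d) with (1 - c * c) by lra.
      f_equal; unfold D; field; split; unfold D in HD; nra. }
    unfold Cdiv. rewrite Heq, <- Cmult_assoc, Cinv_r by exact Hden0. apply Cmult_1_r. }
  rewrite Hquot. unfold z0. rewrite Hx, HT. unfold Cmult; simpl.
  f_equal; field; split; nra.
Qed.

Lemma xdef_klein (k1 k2 x : R) : 0 <= x -> k1 ^ 2 + k2 ^ 2 = 1 - x ^ 2 ->
  xdef (k1 / (1 + x), k2 / (1 + x)) = x.
Proof.
  intros Hx Hk. unfold xdef, Cmod. simpl fst. simpl snd.
  rewrite pow2_sqrt by (apply Rplus_le_le_0_compat; apply pow2_ge_0).
  replace ((k1 / (1 + x)) ^ 2 + (k2 / (1 + x)) ^ 2) with ((k1 ^ 2 + k2 ^ 2) / (1 + x) ^ 2)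
    by (field; lra).
  rewrite Hk. field. split; nra.
Qed.

Lemma integrand_eq (h : C -> C) p beta a s :
  let g1 := fun x y => fst (h (x, y)) in let g2 := fun x y => snd (h (x, y)) in
  let z := gammaH beta a (s + ln (muH a)) in
  (RtoC (Rpower (xdef z) p) * h z)%C =
  (Rpower (muH a) p * (weight p s * kernel g1 s beta (atan a)),
   Rpower (muH a) p * (weight p s * kernel g2 s beta (atan a))).
Proof.
  intros g1 g2 z.
  assert (Hmu : muH a = cos (atan a)).
  { unfold muH. rewrite cos_atan. unfold Rsqr. replace (a * a) with (a ^ 2) by ring.
    field. apply Rgt_not_eq, sqrt_lt_R0. nra. }
  unfold z. rewrite Hmu, gammaH_eq. set (al := atan a).
  assert (Hc : 0 < cos al) by (pose proof (atan_bound a); apply cos_gt_0; unfold al; lra).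
  pose proof (inv_cosh_bound s) as Hk.
  assert (Hx : 0 < x_geod s al) by (apply Rmult_lt_0_compat; lra).
  rewrite xdef_klein by (try apply klein_norm; lra).
  unfold kernel, g1, g2. rewrite inv_ext_eq by lra.
  unfold weight. rewrite <- !Rmult_assoc, Rpower_mult_distr by lra. fold (x_geod s al).
  unfold Rdiv. set (w := (_, _) : C). 
  unfold Cmult, RtoC; simpl. f_equal; ring.
Qed.

(** * Convergence of the improper integral *)

Lemma line_int_lim p M f : 0 < p -> exp_decay p M f -> forall eps, 0 < eps -> exists N,
  forall a b, a <= - N -> N <= b -> Rabs (RInt f a b - line_int f) < eps.
Proof.
  intros Hp Hf eps Heps.
  assert (HM : 0 <= M).
  { destruct Hf as [_ Hd]. specialize (Hd 0). rewrite Rabs_R0, Rmult_0_r, exp_0 in Hd.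
    pose proof (Rabs_pos (f 0)). lra. }
  (* Beyond [q / p] on both sides the tail is at most [2 * (M / p) * e^(-q) = eps * q * e^(-q)],
     which is less than [eps] because [q < 1 + q <= e^q]. *)
  set (q := 2 * (M / p) / eps).
  assert (HMp : 0 <= M / p) by (apply Rmult_le_pos; [|left; apply Rinv_0_lt_compat]; lra).
  assert (Hq : 0 <= q).
  { unfold q. apply Rmult_le_pos; [lra|left; now apply Rinv_0_lt_compat]. }
  assert (HN : 0 <= q / p) by (apply Rmult_le_pos; [|left; apply Rinv_0_lt_compat]; lra).
  exists (q / p). intros a b Ha Hb.
  rewrite Rabs_minus_sym. eapply Rle_lt_trans; [apply (line_int_RInt p M f Hp Hf); lra|].
  assert (Mono : forall y, y <= - (q / p) -> exp (p * y) <= exp (- q)).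
  { intros y Hy. assert (Hpy : p * y <= - q).
    { replace (- q) with (p * - (q / p)) by (field; lra). apply Rmult_le_compat_l; lra. }
    destruct Hpy as [Hpy|Hpy]; [left; now apply exp_increasing|rewrite Hpy; lra]. }
  pose proof (Mono a ltac:(lra)) as E1. pose proof (Mono (- b) ltac:(lra)) as E2.
  replace (p * - b) with (- p * b) in E2 by ring.
  apply Rle_lt_trans with (M / p * (exp (- q) + exp (- q))).
  - apply Rmult_le_compat_l; lra.
  - replace (M / p * (exp (- q) + exp (- q))) with (eps * q * exp (- q)) by (unfold q; field; lra).
    rewrite exp_Ropp. pose proof (exp_pos q). pose proof (exp_ineq1_le q).
    apply Rmult_lt_reg_r with (exp q); [assumption|].
    rewrite Rmult_assoc, Rinv_l by lra. rewrite Rmult_1_r. apply Rmult_lt_compat_l; lra.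
Qed.

Lemma is_RInt_shift_scal p M f m c a b : exp_decay p M f ->
  is_RInt (fun t => m * f (t - c)) a b (m * RInt f (a - c) (b - c)).
Proof.
  intro Hf. apply (is_RInt_scal (V := R_NormedModule) (fun t => f (t - c)) a b m).
  apply (is_RInt_ext (fun t => scal 1 (f (1 * t + - c)))).
  - intros t _. unfold scal; simpl. unfold mult; simpl. rewrite !Rmult_1_l. reflexivity.
  - apply (is_RInt_comp_lin (V := R_NormedModule) f 1 (- c)). rewrite !Rmult_1_l.
    apply (RInt_correct (V := R_CompleteNormedModule)). eapply exp_decay_ex_RInt, Hf.
Qed.

(** The translation by [c] undoes the shift from [t] to [s]: it moves the finite limits of
    integration and disappears in the limit. The tolerance [eps / (|m| + 1)] also covers [m = 0]. *)
Lemma is_RInt_gen_line_int p M1 M2 f1 f2 m c : 0 < p -> exp_decay p M1 f1 -> exp_decay p M2 f2 ->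
  is_RInt_gen (fun t => (m * f1 (t - c), m * f2 (t - c)) : C)
    (Rbar_locally m_infty) (Rbar_locally p_infty) ((m * line_int f1, m * line_int f2) : C).
Proof.
  intros Hp H1 H2 P [eps HP].
  assert (Heps : 0 < eps / (Rabs m + 1)).
  { pose proof (Rabs_pos m). apply Rdiv_lt_0_compat; [apply eps|lra]. }
  destruct (line_int_lim p M1 f1 Hp H1 _ Heps) as [N1 HN1].
  destruct (line_int_lim p M2 f2 Hp H2 _ Heps) as [N2 HN2].
  set (N := Rmax N1 N2). pose proof (Rmax_l N1 N2). pose proof (Rmax_r N1 N2).
  assert (Close : forall u v, Rabs (u - v) < eps / (Rabs m + 1) -> Rabs (m * u - m * v) < eps).
  { intros u v Huv. pose proof (Rabs_pos m).
    rewrite <- Rmult_minus_distr_l, Rabs_mult.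
    apply Rle_lt_trans with (Rabs m * (eps / (Rabs m + 1))).
    - apply Rmult_le_compat_l; lra.
    - assert (E : (Rabs m + 1) * (eps / (Rabs m + 1)) = eps) by (field; lra). lra. }
  exists (fun a => a < - N + c) (fun b => N + c < b).
  - exists (- N + c). auto.
  - exists (N + c). auto.
  - intros a b Ha Hb.
    exists (m * RInt f1 (a - c) (b - c), m * RInt f2 (a - c) (b - c)). split.
    + apply (is_RInt_fct_extend_pair (U := R_NormedModule) (V := R_NormedModule)
        (fun t => (m * f1 (t - c), m * f2 (t - c))) a b).
      * eapply is_RInt_shift_scal, H1.
      * eapply is_RInt_shift_scal, H2.
    + apply HP. split; apply Close; [apply HN1|apply HN2]; unfold N in *; lra.
Qed.

(** I_0^H (x^(2+2 gamma) h) = mu_H^(2 gamma + 2) (u o Psi_hf) with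
    u in C^infinity_{alpha,+}; the (improper) integral over t in R converges. *)
Theorem theorem2p2 (gam : R) (hgam : -1 < gam) (h : C -> C) (hh : Cinf_ev h) :
  exists u : R -> R -> C,
    Cinf_alpha_plus u /\
    forall beta a : R,
      is_RInt_gen
        (fun t => (RtoC (Rpower (xdef (gammaH beta a t)) (2 + 2 * gam))
                   * h (gammaH beta a t))%C)
        (Rbar_locally m_infty) (Rbar_locally p_infty)
        (RtoC (Rpower (muH a) (2 * gam + 2)) * u beta (atan a))%C.
Proof.
  destruct hh as [[S1 S2] Hev].
  set (g1 := fun x y => fst (h (x, y))). set (g2 := fun x y => snd (h (x, y))).
  pose proof (smooth2_Cinf2 g1 S1) as C1. pose proof (smooth2_Cinf2 g2 S2) as C2.
  rewrite (Rplus_comm 2). set (p := 2 * gam + 2). assert (Hp : 0 < p) by (unfold p; lra).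
  exists (fun beta al => (fan_int p g1 beta al, fan_int p g2 beta al)). split.
  - apply Cinf_alpha_plus_fan_int; auto; intros k om; apply Hev.
  - intros beta a.
    assert (Dec : forall g, Cinf2 g ->
      exists M, exp_decay p M (fun s => weight p s * kernel g s beta (atan a))).
    { intros g Hg. pose proof (Cinf_kernel g Hg 0%nat) as CK.
      destruct (Ck_bounded _ _ CK (Rabs beta + Rabs (atan a))) as [M HM].
      pose proof (Rabs_pos beta). pose proof (Rabs_pos (atan a)).
      exists (Rpower 2 p * M). apply exp_decay_mult; [now apply weight_decay| |].
      - intro s. apply (Ck_continuous _ _ CK).
      - intro s. apply HM; lra. }
    destruct (Dec g1 C1) as [M1 D1]. destruct (Dec g2 C2) as [M2 D2].
    replace (_ * _)%C with ((Rpower (muH a) p * fan_int p g1 beta (atan a),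
      Rpower (muH a) p * fan_int p g2 beta (atan a)) : C)
      by (unfold Cmult, RtoC; simpl; f_equal; ring).
    apply (is_RInt_gen_ext (V := C_R_NormedModule)
      (fun t => let s := t - ln (muH a) in
        (Rpower (muH a) p * (weight p s * kernel g1 s beta (atan a)),
         Rpower (muH a) p * (weight p s * kernel g2 s beta (atan a))) : C)).
    + apply filter_forall. intros ab t _.
      pose proof (integrand_eq h p beta a (t - ln (muH a))) as E. simpl in E.
      replace (t - ln (muH a) + ln (muH a)) with t in E by ring. symmetry. exact E.
    + apply (is_RInt_gen_line_int p M1 M2
        (fun s => weight p s * kernel g1 s beta (atan a))
        (fun s => weight p s * kernel g2 s beta (atan a))); auto.
Qed.
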